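(* Let $\mathbf{F}$ be a finite field with $q$ elements, let $(G,\mathbf{V})$ be the infinite symplectic group over $\mathbf{F}$, let $\mathbb{B}=\mathbb{B}(G,\mathbf{V})$ be its relative Burnside ring, with basis the classes $x_{a,b}$ of the $G$-sets $X_{a,b}$, and let $\delta\colon\mathbb{B}\to\mathbb{B}$ be the ring homomorphism induced by restriction to $G(1)\cong G$. Then $$\delta(x_{1,0})=q^2x_{1,0}+(q^3-q)(x_{0,1}+1)^2,\qquad \delta(x_{0,1})=q^2x_{0,1}+q^2-1.$$ In particular, $\delta$ is an isomorphism after inverting $q$.
   Context: A structure is an $\mathbf{F}$-vector space with an alternating bilinear form; an embedding is an injective linear map preserving forms. $\mathbf{V}$ has basis $\{e_i,f_i\}_{i\ge1}$ and form $\langle e_i,e_j\rangle=\langle f_i,f_j\rangle=0$, $\langle e_i,f_j\rangle=\delta_{i,j}$; $G$ is its group of form-preserving linear automorphisms. $V_{m,n}$ is the space of dimension $2m+n$ that is the orthogonal sum of a non-degenerate symplectic space of dimension $2m$ and an $n$-dimensional space with zero form. $X_{m,n}$ is the set of embeddings $V_{m,n}\to\mathbf{V}$, with its transitive $G$-action by post-composition. A $G$-set is $\mathbf{V}$-smooth if all its stabilizers are pointwise stabilizers $G(A)$ of finite subsets $A\subset\mathbf{V}$; the $X_{m,n}$ are, up to isomorphism, exactly the transitive ones. The relative Burnside ring $\mathbb{B}(G,\mathbf{V})$ is the free abelian group on isomorphism classes of transitive $\mathbf{V}$-smooth $G$-sets, with the class of a $\mathbf{V}$-smooth $G$-set with finitely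 many orbits defined as the sum of the classes of its orbits, and product given by the class of the Cartesian product. $G(1)\subset G$ is the subgroup fixing $e_1$ and $f_1$, and $\mathbf{V}(1)\subset\mathbf{V}$ is the span of $e_i,f_i$ with $i>1$. Shifting indices gives an isomorphism of pairs $(G(1),\mathbf{V}(1))\cong(G,\mathbf{V})$. Restricting $\mathbf{V}$-smooth $G$-sets with finitely many orbits to $G(1)$ gives a ring homomorphism $\mathbb{B}(G,\mathbf{V})\to\mathbb{B}(G(1),\mathbf{V}(1))$, and $\delta$ is its composite with the identification $\mathbb{B}(G(1),\mathbf{V}(1))\cong\mathbb{B}(G,\mathbf{V})$. *)

(* Defs.v *)
From HB Require Import structures.
From mathcomp Require Import all_boot all_order all_algebra generic_quotient.
From mathcomp Require Import mathcomp_extra boolp classical_sets functions.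
From mathcomp Require Import cardinality fsbigop freeg ring zify.

Set Implicit Arguments.
Unset Strict Implicit.
Unset Printing Implicit Defensive.

Import GRing.Theory.
Local Open Scope classical_set_scope.
Local Open Scope quotient_scope.
Local Open Scope ring_scope.

#[local] Obligation Tactic := idtac.

Record gset (G : groupType) := GSet {
  gcarrier :> Type;
  gact : G -> gcarrier -> gcarrier;
  gact1 : forall x, gact 1%g x = x;
  gactM : forall g h x, gact (g * h)%g x = gact g (gact h x) }.

Definition equivariant (G : groupType) (X Y : gset G) (f : X -> Y) :=
  forall g x, f (gact g x) = gact g (f x).

Definition gset_iso (G : groupType) (X Y : gset G) :=
  exists f : X -> Y, bijective f /\ equivariant f.

Section GSets.
Variable G : groupType.
Implicit Types X Y Z : gset G.

Definition gorbit X (x : X) : set X := [set y | exists g, y = gact g x].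
Definition gorbits X : set (set X) := range (@gorbit X).
Arguments gorbits : clear implicits.
Definition fin_orbits X := finite_set (gorbits X).

Definition gtransitive X :=
  exists x : X, forall y : X, exists g, y = gact g x.

Definition stab X (x : X) : set G := [set g | gact g x = x].

Definition fixer X (A : set X) : set G :=
  [set g | forall a, A a -> gact g a = a].

Definition smooth (Omega X : gset G) :=
  forall x : X, exists A : set Omega, finite_set A /\ stab x = fixer A.

Program Definition gprod X Y : gset G :=
  @GSet G (X * Y)%type (fun g p => (gact g p.1, gact g p.2)) _ _.
Next Obligation. by move=> X Y [x y] /=; rewrite !gact1. Qed.
Next Obligation. by move=> X Y g h [x y] /=; rewrite !gactM. Qed.

Program Definition gsum X Y : gset G :=
  @GSet G (X + Y)%type (fun g p => match p with
    | inl x => inl (gact g x) | inr y => inr (gact g y) end) _ _.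
Next Obligation. by move=> X Y [x|y] /=; rewrite gact1. Qed.
Next Obligation. by move=> X Y g h [x|y] /=; rewrite gactM. Qed.

Program Definition gpower X n : gset G :=
  @GSet G ('I_n -> X) (fun g s i => gact g (s i)) _ _.
Next Obligation. by move=> X n s; apply/funext => i; rewrite gact1. Qed.
Next Obligation. by move=> X n g h s; apply/funext => i; rewrite gactM. Qed.

Program Definition gpoint : gset G := @GSet G unit (fun _ x => x) _ _.
Next Obligation. by []. Qed.
Next Obligation. by []. Qed.

Program Definition gempty : gset G := @GSet G False (fun _ x => x) _ _.
Next Obligation. by []. Qed.
Next Obligation. by []. Qed.

Definition ginvariant X (A : set X) := forall g x, A x -> A (gact g x).

Program Definition gsub X (A : set X) (AG : ginvariant A) : gset G :=
  @GSet G {x : X | A x}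
    (fun g x => exist A (gact g (sval x)) (AG g _ (proj2_sig x))) _ _.
Next Obligation. by move=> X A AG [x Ax]; apply: eq_exist; rewrite /= gact1. Qed.
Next Obligation. by move=> X A AG g h [x Ax]; apply: eq_exist; rewrite /= gactM. Qed.

(* Subsets of G with the translation action: the left cosets of a subgroup U
   form the orbit of U. *)
Program Definition gsetset : gset G :=
  @GSet G (set G) (fun g U => [set (g * u)%g | u in U]) _ _.
Next Obligation.
move=> U; apply/seteqP; split => [_ [u Uu <-]|u Uu]; first by rewrite mul1g.
by exists u => //; rewrite mul1g.
Qed.
Next Obligation.
move=> g h U; apply/seteqP; split => [_ [u Uu <-]|_ [_ [u Uu <-] <-]].
  by exists (h * u)%g; [exists u|rewrite mulgA].
by exists u; rewrite ?mulgA.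
Qed.

Lemma gorbit_invariant X (x : X) : ginvariant (gorbit x).
Proof. by move=> g _ [h ->]; exists (g * h)%g; rewrite gactM. Qed.

Definition gorbit_gset X (x : X) : gset G := gsub (@gorbit_invariant X x).

Definition coset_gset (U : set G) : gset G := gorbit_gset (U : gsetset).

Lemma gactK X (g : G) : cancel (@gact G X g) (gact g^-1%g).
Proof. by move=> x; rewrite -gactM mulVg gact1. Qed.

Lemma gactVK X (g : G) : cancel (@gact G X g^-1%g) (gact g).
Proof. by move=> x; rewrite -gactM mulgV gact1. Qed.

Lemma gact_inj X (g : G) : injective (@gact G X g).
Proof. exact: can_inj (gactK g). Qed.

Lemma gorbit_refl X (x : X) : gorbit x x.
Proof. by exists 1%g; rewrite gact1. Qed.

Lemma gorbit_act X (x : X) g : gorbit (gact g x) = gorbit x.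
Proof.
apply/seteqP; split => [_ [h ->]|_ [h ->]]; first by exists (h * g)%g; rewrite gactM.
by exists (h * g^-1)%g; rewrite gactM gactK.
Qed.

Lemma gorbit_eq X (x y : X) : gorbit x y -> gorbit y = gorbit x.
Proof. by case=> g ->; exact: gorbit_act. Qed.

Lemma gset_iso_refl X : gset_iso X X.
Proof. by exists id; split => //; exists id. Qed.

Lemma gset_iso_sym X Y : gset_iso X Y -> gset_iso Y X.
Proof.
move=> [f [[h fK hK] fG]]; exists h; split; first by exists f.
by move=> g y; rewrite -{1}[y]hK -fG fK.
Qed.

Lemma gset_iso_trans X Y Z : gset_iso X Y -> gset_iso Y Z -> gset_iso X Z.
Proof.
move=> [f [bf fG]] [h [bh hG]]; exists (h \o f); split; first exact: bij_comp.
by move=> g x; rewrite /= fG hG.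
Qed.

Lemma gset_iso_bij X Y (f : X -> Y) : injective f ->
  (forall y, exists x, y = f x) -> equivariant f -> gset_iso X Y.
Proof.
move=> fI fS fG; exists f; split => //.
pose h y := projT1 (cid (fS y)).
have hK y : f (h y) = y by rewrite /h; case: cid.
by exists h => // x; apply: fI; rewrite hK.
Qed.

Lemma gprod_iso X X' Y Y' :
  gset_iso X X' -> gset_iso Y Y' -> gset_iso (gprod X Y) (gprod X' Y').
Proof.
move=> [f [[f' fK f'K] fG]] [h [[h' hK h'K] hG]].
exists (fun p => (f p.1, h p.2)); split; last by move=> g [x y] /=; rewrite fG hG.
by exists (fun p => (f' p.1, h' p.2)) => -[x y] /=; rewrite ?fK ?hK ?f'K ?h'K.
Qed.

Lemma gprodC_iso X Y : gset_iso (gprod X Y) (gprod Y X).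
Proof.
by exists (fun p => (p.2, p.1)); split => //; exists (fun p => (p.2, p.1)) => -[].
Qed.

Lemma gprodA_iso X Y Z :
  gset_iso (gprod X (gprod Y Z)) (gprod (gprod X Y) Z).
Proof.
exists (fun p => ((p.1, p.2.1), p.2.2)); split => //.
by exists (fun p => (p.1.1, (p.1.2, p.2))); [case=> ? [] | case=> -[]].
Qed.

Lemma gprod1_iso X : gset_iso (gprod gpoint X) X.
Proof. by exists snd; split => //; exists (pair tt) => [[[] x]|]. Qed.

Lemma gprod_sum_iso X Y Z :
  gset_iso (gprod (gsum X Y) Z) (gsum (gprod X Z) (gprod Y Z)).
Proof.
exists (fun p => match p.1 with inl x => inl (x, p.2) | inr y => inr (y, p.2) end).
split; last by move=> g [[x|y] z].
by exists (fun s => match s with inl p => (inl p.1, p.2) | inr p => (inr p.1, p.2) end)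
  => [[[x|y] z]|[[]|[]]].
Qed.

Lemma gprod0_iso X : gset_iso (gprod gempty X) gempty.
Proof. by exists fst; split => [|g []//]; exists (False_rect _) => [[]|[]]. Qed.

Lemma gcoset_iso X (x0 : X) :
  (forall y : X, exists g, y = gact g x0) -> gset_iso X (coset_gset (stab x0)).
Proof.
move=> tr.
have cosetP (g : G) : [set h | gact h x0 = gact g x0] = [set (g * u)%g | u in stab x0].
  apply/seteqP; split => [h /= e|_ [u /= e <-]]; last by rewrite /= gactM e.
  by exists (g^-1 * h)%g; rewrite ?mulVKg // /stab /= gactM e gactK.
have fP (x : X) : gorbit (stab x0 : gsetset) [set h | gact h x0 = x].
  by have [g ->] := tr x; exists g; rewrite cosetP.
pose f (x : X) : coset_gset (stab x0) := exist _ _ (fP x).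
apply: (@gset_iso_bij _ _ f).
- move=> x y /= [e]; have [g xg] := tr x.
  have : [set h | gact h x0 = x] g by [].
  by rewrite e /= => <-.
- move=> [U [g eU]]; exists (gact g x0); apply: eq_exist.
  by rewrite eU; exact/esym/cosetP.
- move=> g x; apply: eq_exist; have [h ->] := tr x.
  by rewrite /= -gactM !cosetP; exact: (@gactM _ gsetset).
Qed.

End GSets.
Arguments gorbits {G} X.

Definition of_ord0 T (i : 'I_0) : T := False_rect T (notF (ltn_ord i)).

Section GSets2.
Variable G : groupType.
Implicit Types X Y Z : gset G.

Lemma gsub_iso_eq X (A B : set X) (AG : ginvariant A) (BG : ginvariant B) :
  A = B -> gset_iso (gsub AG) (gsub BG).
Proof.
move=> e; case: _ / e BG => BG.
by rewrite (Prop_irrelevance BG AG); exact: gset_iso_refl.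
Qed.

Lemma stab_gact X (x : X) (g : G) :
  stab (gact g x) = [set h | stab x (g^-1 * h * g)%g].
Proof.
apply/seteqP; split => h; rewrite /stab /= => e.
  by rewrite !gactM e gactK.
by apply: (@gact_inj _ X g^-1%g); rewrite gactK -!gactM.
Qed.

Lemma stab_mulVg X (x : X) (g g' : G) :
  stab x (g'^-1 * g)%g -> gact g x = gact g' x.
Proof. by rewrite /stab /= gactM => e; rewrite -[in RHS]e gactVK. Qed.

Lemma stab_inj X Y (f : X -> Y) (x : X) :
  injective f -> equivariant f -> stab (f x) = stab x.
Proof.
move=> fI fG; apply/seteqP; split => g; rewrite /stab /= -fG; first exact: fI.
by move=> ->.
Qed.

Lemma gorbit_map X Y (f : X -> Y) (x : X) : equivariant f ->
  gorbit (f x) = f @` gorbit x.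
Proof.
move=> fG; apply/seteqP; split => [_ [g ->]|_ [_ [g ->] <-]].
  by exists (gact g x); [exists g|rewrite fG].
by exists g; rewrite fG.
Qed.

Lemma gorbits_iso X Y (f : X -> Y) : equivariant f ->
  (forall y, exists x, y = f x) -> gorbits Y = [set f @` O | O in gorbits X].
Proof.
move=> fG fS; apply/seteqP; split => [_ [y _ <-]|_ [_ [x _ <-] <-]].
  have [x ->] := fS y; rewrite gorbit_map //.
  by exists (gorbit x) => //; exists x.
by exists (f x) => //; rewrite gorbit_map.
Qed.

Lemma gorbits_sum X Y : gorbits (gsum X Y) =
  [set inl @` O | O in gorbits X] `|` [set inr @` O | O in gorbits Y].
Proof.
have lG : @equivariant G X (gsum X Y) inl by [].
have rG : @equivariant G Y (gsum X Y) inr by [].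
apply/seteqP; split => [_ [[x|y] _ <-]|_ [[_ [x _ <-] <-]|[_ [y _ <-] <-]]].
- by left; exists (gorbit x); [exists x|rewrite -(gorbit_map x lG)].
- by right; exists (gorbit y); [exists y|rewrite -(gorbit_map y rG)].
- by exists (inl x) => //; rewrite -(gorbit_map x lG).
- by exists (inr y) => //; rewrite -(gorbit_map y rG).
Qed.

Lemma gtransitive_orbits X (x0 : X) :
  (forall y : X, exists g, y = gact g x0) -> gorbits X = [set gorbit x0].
Proof.
move=> tr; apply/seteqP; split => [_ [x _ <-]|_ ->]; last by exists x0.
by apply: gorbit_eq; have [g ->] := tr x; exists g.
Qed.

Lemma fin_orbits_rel X Y (R : X -> Y -> Prop) : fin_orbits X ->
  (forall g x y, R x y -> R (gact g x) (gact g y)) ->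
  (forall x y y', R x y -> R x y' -> y = y') ->
  finite_set [set O | exists x y, R x y /\ O = gorbit y].
Proof.
move=> fX RG Rf.
apply: sub_finite_set (finite_image (fun O => [set y | exists2 x, O x & R x y]) fX).
move=> _ [x [y [Rxy ->]]]; exists (gorbit x); first by exists x.
apply/seteqP; split => [y' [_ [g ->] Ry']|_ [g ->]].
  by exists g; apply: Rf Ry' (RG g _ _ Rxy).
by exists (gact g x); [exists g|exact: RG].
Qed.

Lemma fin_orbits_reps X : fin_orbits X ->
  exists n (r : 'I_n -> X), forall x, exists i g, x = gact g (r i).
Proof.
move=> /finite_seqP [s es].
have [|x0] := pselect (exists x : X, True); last first.
  exists 0, (@of_ord0 X) => x.
  by case: x0; exists x.
move=> [x0 _].
have P (i : 'I_(size s)) : exists x : X, nth set0 s i = gorbit x.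
  have : [set` s] (nth set0 s i) by rewrite /= mem_nth.
  by rewrite -es => -[x _ <-]; exists x.
exists (size s), (fun i => projT1 (cid (P i))) => x.
have : gorbits X (gorbit x) by exists x.
rewrite es /= => xs; have ltx : (index (gorbit x) s < size s)%N by rewrite index_mem.
exists (Ordinal ltx); case: cid => y /=; rewrite nth_index // => e.
by have := gorbit_refl x; rewrite e => -[g ->]; exists g.
Qed.

Lemma fin_orbits_cover X n (r : 'I_n -> X) :
  (forall x, exists i g, x = gact g (r i)) -> fin_orbits X.
Proof.
move=> rP; apply: sub_finite_set (finite_image (fun i => gorbit (r i)) (@finite_finset 'I_n setT)).
by move=> _ [x _ <-]; have [i [g ->]] := rP x; exists i; rewrite ?gorbit_act.
Qed.

End GSets2.

Lemma finite_set_tuple (T : Type) (A : set T) : finite_set A ->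
  exists n (a : 'I_n -> T), A = range a.
Proof.
elim/Pchoice: T => T in A * => /finite_seqP [s ->].
exists (size s), (fun i => tnth (in_tuple s) i).
apply/seteqP; split => [x /= xs|_ [i _ <-]]; last exact: mem_tnth.
by have [i ->] := tnthP (in_tuple s) x xs; exists i.
Qed.

(* A group acting on a set with finitely many orbits on each finite power; this
   is what keeps the number of orbits of a product of G-sets finite, so that
   the product of the relative Burnside ring is defined. *)
Record opair := OPair {
  pgrp : groupType;
  pset : gset pgrp;
  poligo : forall n, fin_orbits (gpower pset n) }.

Record sgset (P : opair) := SGset {
  sg_gset :> gset (pgrp P);
  sg_smooth : smooth (pset P) sg_gset;
  sg_fin : fin_orbits sg_gset }.

Program Definition gpull (G H : groupType) (h : G -> H)
   (hM : {morph h : x y / (x * y)%g}) (X : gset H) : gset G :=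
  @GSet G X (fun g => gact (h g)) _ _.
Next Obligation.
move=> G H h hM X x.
have -> : h 1%g = 1%g by apply: (@mulgI _ (h 1%g)); rewrite -hM !mulg1.
exact: gact1.
Qed.
Next Obligation. by move=> G H h hM X g g' x /=; rewrite hM gactM. Qed.

(* A group homomorphism along which smooth G-sets with finitely many orbits pull
   back to smooth G-sets with finitely many orbits. *)
Record pair_hom (P Q : opair) := PairHom {
  phom :> pgrp P -> pgrp Q;
  phomM : {morph phom : x y / (x * y)%g};
  phom_smooth : forall A : set (pset Q), finite_set A ->
    exists B : set (pset P), finite_set B /\ phom @^-1` fixer A = fixer B;
  phom_oligo : forall n, fin_orbits (gpull phomM (gpower (pset Q) n)) }.

Lemma gpull_smooth P Q (h : pair_hom P Q) (X : sgset Q) :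
  smooth (pset P) (gpull (phomM h) X).
Proof.
move=> x; have [A [fA eA]] := sg_smooth x.
have [B [fB eB]] := phom_smooth h fA.
by exists B; split => //; rewrite -eB -eA.
Qed.

Lemma fixer_tuple (G : groupType) (X : gset G) n (a : 'I_n -> X) (g g' : G) :
  (forall i, gact g (a i) = gact g' (a i)) <-> fixer (range a) (g'^-1 * g)%g.
Proof.
split => [e _ [i _ <-]|e i]; first by rewrite gactM e gactK.
by rewrite -[in RHS](e (a i)) // gactM gactVK.
Qed.

Lemma gpull_fin P Q (h : pair_hom P Q) (X : sgset Q) :
  fin_orbits (gpull (phomM h) X).
Proof.
have [m [r rP]] := fin_orbits_reps (sg_fin X).
pose F i := [set O : set X | exists g, O = @gorbit _ (gpull (phomM h) X) (gact g (r i))].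
apply: (@sub_finite_set _ _ (\bigcup_(i in [set: 'I_m]) F i)).
  by move=> _ [x _ <-]; have [i [g ->]] := rP x; exists i => //; exists g.
apply: bigcup_finite => [|i _]; first exact: finite_finset.
have [A [fA eA]] := sg_smooth (r i); have [n [a Aa]] := finite_set_tuple fA.
pose R (s : gpull (phomM h) (gpower (pset Q) n)) (t : gpull (phomM h) X) :=
  exists g, (forall k, s k = gact g (a k)) /\ t = gact g (r i).
apply: sub_finite_set (@fin_orbits_rel _ _ _ R (phom_oligo h n) _ _).
- move=> _ [g ->]; exists (fun k => gact g (a k)), (gact g (r i)).
  by split => //; exists g.
- move=> g s t [g' [es ->]]; exists (h g * g')%g; split => [k|].
    by rewrite gactM -es.
  by rewrite gactM.
- move=> s t t' [g [es ->]] [g' [es' ->]].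
  have : fixer (range a) (g'^-1 * g)%g by apply/fixer_tuple => k; rewrite -es.
  by rewrite -Aa -eA => /stab_mulVg.
Qed.

Definition spull P Q (h : pair_hom P Q) (X : sgset Q) : sgset P :=
  SGset (@gpull_smooth P Q h X) (gpull_fin h X).

Section Smooth.
Variable P : opair.
Implicit Types X Y Z : sgset P.

Lemma gprod_smooth X Y : smooth (pset P) (gprod X Y).
Proof.
move=> [x y]; have [A [fA eA]] := sg_smooth x; have [B [fB eB]] := sg_smooth y.
exists (A `|` B); split; first by rewrite finite_setU.
have -> : fixer (A `|` B) = fixer A `&` fixer B.
  apply/seteqP; split => [g e|g [e e'] z [/e|/e']//].
  by split => z zA; apply: e; [left|right].
rewrite -eA -eB; apply/seteqP; split => [g [e e'] //|g []].
by rewrite /stab /= => -> ->.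
Qed.

Lemma gprod_fin X Y : fin_orbits (gprod X Y).
Proof.
have [m [r rP]] := fin_orbits_reps (sg_fin X).
have [n [s sP]] := fin_orbits_reps (sg_fin Y).
pose F (p : 'I_m * 'I_n) := [set O : set (X * Y) | exists g g',
  O = @gorbit _ (gprod X Y) (gact g (r p.1), gact g' (s p.2))].
apply: (@sub_finite_set _ _ (\bigcup_(p in setT) F p)).
  move=> _ [[x y] _ <-]; have [i [g ->]] := rP x; have [j [g' ->]] := sP y.
  by exists (i, j) => //; exists g, g'.
apply: bigcup_finite => [|[i j] _]; first exact: finite_finset.
have [A [fA eA]] := sg_smooth (r i); have [k [a Aa]] := finite_set_tuple fA.
have [B [fB eB]] := sg_smooth (s j); have [l [b Bb]] := finite_set_tuple fB.
pose R (u : gpower (pset P) (k + l)) (t : gprod X Y) := exists g g',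
  [/\ forall i, u (lshift l i) = gact g (a i),
      forall i, u (rshift k i) = gact g' (b i)
    & t = (gact g (r i), gact g' (s j))].
apply: sub_finite_set (@fin_orbits_rel _ _ _ R (poligo P (k + l)) _ _).
- move=> _ [g [g' ->]].
  exists (fun c => match fintype.split c with inl i => gact g (a i) | inr i => gact g' (b i) end).
  exists (gact g (r i), gact g' (s j)); split => //; exists g, g'; split => // c.
    by rewrite (unsplitK (inl c)).
  by rewrite (unsplitK (inr c)).
- move=> g u t [h [h' [e e' ->]]]; exists (g * h)%g, (g * h')%g.
  by split => [c|c|] /=; rewrite ?e ?e' !gactM.
- move=> u t t' [g [g' [e1 e2 ->]]] [h [h' [e3 e4 ->]]]; congr (_, _).
    have : fixer (range a) (h^-1 * g)%g by apply/fixer_tuple => c; rewrite -e1.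
    by rewrite -Aa -eA => /stab_mulVg.
  have : fixer (range b) (h'^-1 * g')%g by apply/fixer_tuple => c; rewrite -e2.
  by rewrite -Bb -eB => /stab_mulVg.
Qed.

Definition sprod X Y : sgset P := SGset (@gprod_smooth X Y) (gprod_fin X Y).

Lemma gsum_smooth X Y : smooth (pset P) (gsum X Y).
Proof.
move=> [x|y]; [have [A [fA eA]] := sg_smooth x|have [A [fA eA]] := sg_smooth y];
  exists A; split => //; rewrite -eA; [exact: (@stab_inj _ X (gsum X Y) inl x inl_inj)
  | exact: (@stab_inj _ Y (gsum X Y) inr y inr_inj)].
Qed.

Lemma gsum_fin X Y : fin_orbits (gsum X Y).
Proof.
rewrite /fin_orbits gorbits_sum finite_setU.
by split; apply: finite_image; exact: sg_fin.
Qed.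

Definition ssum X Y : sgset P := SGset (@gsum_smooth X Y) (gsum_fin X Y).

Lemma gempty_smooth : smooth (pset P) (gempty (pgrp P)).
Proof. by []. Qed.

Lemma gempty_fin : fin_orbits (gempty (pgrp P)).
Proof. by apply: (@fin_orbits_cover _ (gempty (pgrp P)) 0 (@of_ord0 _)). Qed.

Definition sempty : sgset P := SGset gempty_smooth gempty_fin.

Lemma gpoint_smooth : smooth (pset P) (gpoint (pgrp P)).
Proof. by move=> x; exists set0; split => //; apply/seteqP; split => [g _ a []|]. Qed.

Lemma gpoint_fin : fin_orbits (gpoint (pgrp P)).
Proof. by apply: (@fin_orbits_cover _ (gpoint (pgrp P)) 1 (fun=> tt)) => -[]; exists ord0, 1%g. Qed.

Definition spoint : sgset P := SGset gpoint_smooth gpoint_fin.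

Record smooth_subgroup := SmoothSubgroup {
  ssub :> set (pgrp P);
  ssubP : exists A : set (pset P), finite_set A /\ ssub = fixer A }.

Lemma smooth_subgroup_eq (U U' : smooth_subgroup) : ssub U = ssub U' -> U = U'.
Proof.
case: U U' => [U UP] [U' UP'] /= e; rewrite e in UP *.
by congr SmoothSubgroup; exact: Prop_irrelevance.
Qed.

Definition sstab X (x : X) : smooth_subgroup := SmoothSubgroup (sg_smooth x).

Lemma fixer1 (X : gset (pgrp P)) (A : set X) : fixer A 1%g.
Proof. by move=> a _; rewrite gact1. Qed.
Lemma fixerM (X : gset (pgrp P)) (A : set X) g h :
  fixer A g -> fixer A h -> fixer A (g * h)%g.
Proof. by move=> Ag Ah a Aa; rewrite gactM Ah // Ag. Qed.
Lemma fixerV (X : gset (pgrp P)) (A : set X) g :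
  fixer A g -> fixer A g^-1%g.
Proof. by move=> Ag a Aa; rewrite -{1}(Ag a Aa) gactK. Qed.

Lemma stab_coset (U : smooth_subgroup) (x : coset_gset U) :
  exists2 g : pgrp P, sval x = gact g (ssub U : gsetset _) &
    stab x = [set h | ssub U (g^-1 * h * g)%g].
Proof.
case: x => [C [g eC]]; exists g => //.
have -> : stab (exist _ C (ex_intro _ g eC) : coset_gset U) = stab (C : gsetset _).
  apply/seteqP; split => [h /(congr1 sval)//|h e].
  exact: eq_exist.
rewrite eC stab_gact; apply/seteqP; have [A [_ ->]] := ssubP U.
split => h; rewrite /stab /=.
  move: (_ * _ * _)%g => k e.
  have : fixer A k by rewrite -e; exists 1%g; rewrite ?mulg1 //; exact: fixer1.
  by [].
move: (_ * _ * _)%g => k Ak; apply/seteqP; split => [_ [u Au <-]|u Au].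
  exact: fixerM.
by exists (k^-1 * u)%g; rewrite ?mulVKg //; apply: fixerM => //; exact: fixerV.
Qed.

Lemma coset_smooth (U : smooth_subgroup) : smooth (pset P) (coset_gset U).
Proof.
move=> x; have [g _ ->] := stab_coset x; have [A [fA eA]] := ssubP U.
exists (gact g @` A); split; first exact: finite_image.
rewrite eA; apply/seteqP; split => [h Ah _ [a Aa <-]|h Ah a Aa].
  by apply: (@gact_inj _ _ g^-1%g); rewrite -!gactM Ah // mulVg gact1.
by rewrite -mulgA !gactM Ah ?gactK //; exists a.
Qed.

Lemma coset_transitive (U : set (pgrp P)) :
  exists x0 : coset_gset U, forall y, exists g, y = gact g x0.
Proof.
exists (exist _ _ (gorbit_refl (U : gsetset _))) => -[C [g eC]].
by exists g; apply: eq_exist.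
Qed.

Lemma coset_fin (U : smooth_subgroup) : fin_orbits (coset_gset U).
Proof.
have [x0 tr] := coset_transitive U.
apply: (@fin_orbits_cover _ (coset_gset U) 1 (fun=> x0)) => y.
by have [g ->] := tr y; exists ord0, g.
Qed.

Definition scoset (U : smooth_subgroup) : sgset P :=
  SGset (@coset_smooth U) (@coset_fin U).

Definition coset_isob (U U' : {classic smooth_subgroup}) : bool :=
  `[< gset_iso (coset_gset (ssub U)) (coset_gset (ssub U')) >].

Lemma coset_isob_refl : reflexive coset_isob.
Proof. by move=> U; apply/asboolP; exact: gset_iso_refl. Qed.

Lemma coset_isob_sym : symmetric coset_isob.
Proof.
by move=> U U'; apply/asboolP/asboolP; exact: gset_iso_sym.
Qed.

Lemma coset_isob_trans : transitive coset_isob.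
Proof.
by move=> U' U U'' /asboolP i /asboolP i'; apply/asboolP; exact: gset_iso_trans i'.
Qed.

Canonical coset_isob_equiv :=
  EquivRel coset_isob coset_isob_refl coset_isob_sym coset_isob_trans.

(* Isomorphism classes of transitive smooth G-sets.  All transitive smooth G-sets
   together live in too large a universe to index a MathComp ring, so the
   classes are taken over the coset spaces G/U of the pointwise stabilizers U of
   finite sets, two of them being identified when they are isomorphic as
   G-sets.  Every transitive smooth G-set is isomorphic to one of them
   ([gtransitive_coset]); the class of the orbit of a point x is that of
   G/Stab(x), and two orbits have the same class exactly when they are
   isomorphic ([sstab_iclass]). *)
Definition isoclass := {eq_quot coset_isob_equiv}.
HB.instance Definition _ := Choice.on isoclass.
HB.instance Definition _ := EqQuotient.on isoclass.

Definition iclass (U : smooth_subgroup) : isoclass :=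
  \pi_isoclass (U : {classic smooth_subgroup}).

Definition irepr (c : isoclass) : smooth_subgroup := repr c.

Lemma ireprK c : iclass (irepr c) = c.
Proof. exact: reprK. Qed.

Lemma iclass_eq (U U' : smooth_subgroup) :
  iclass U = iclass U' <-> gset_iso (scoset U) (scoset U').
Proof.
split => [/eqmodP /asboolP//|i]; exact/eqmodP/asboolP.
Qed.

Lemma gtransitive_coset (X : gset (pgrp P)) : smooth (pset P) X ->
  gtransitive X -> exists U : smooth_subgroup, gset_iso X (scoset U).
Proof.
move=> sX [x0 tr]; exists (SmoothSubgroup (sX x0)); exact: gcoset_iso.
Qed.

Lemma sstab_iclass X Y (x : X) (y : Y) :
  iclass (sstab x) = iclass (sstab y) <-> gset_iso (gorbit_gset x) (gorbit_gset y).
Proof.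
have st Z (z : Z) : gset_iso (gorbit_gset z) (scoset (sstab z)).
  have := @gcoset_iso _ (gorbit_gset z) (exist _ z (gorbit_refl z)).
  have -> : stab (exist _ z (gorbit_refl z) : gorbit_gset z) = stab z.
    apply/seteqP; split => [g /(congr1 sval)//|g e]; exact: eq_exist.
  by apply => -[w [g e]]; exists g; exact: eq_exist.
rewrite iclass_eq; split => i.
  exact: gset_iso_trans (st _ x) (gset_iso_trans i (gset_iso_sym (st _ y))).
exact: gset_iso_trans (gset_iso_sym (st _ x)) (gset_iso_trans i (st _ y)).
Qed.

End Smooth.

Definition burnside (P : opair) := {freeg (isoclass P) / int}.
HB.instance Definition _ P := GRing.Lmodule.on (burnside P).

Section Class.
Variable P : opair.
Implicit Types X Y Z : sgset P.

Definition bgen (c : isoclass P) : burnside P := [freeg [:: (1, c)]].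

(* The class of an orbit O, computed at an arbitrary point of O; the value does
   not depend on the point ([orbit_class_gorbit]). *)
Definition orbit_class X (O : set X) : burnside P :=
  if pselect (exists x, O x) is left ex
  then bgen (iclass (sstab (projT1 (cid ex)))) else 0.

Definition gclass X : burnside P := \sum_(O \in gorbits X) orbit_class O.

Lemma orbit_class_gorbit X (x : X) :
  orbit_class (gorbit x) = bgen (iclass (sstab x)).
Proof.
rewrite /orbit_class; case: pselect => [ex|[]]; last by exists x; exact: gorbit_refl.
case: cid => y /= xy; congr bgen; apply/sstab_iclass.
exact/gsub_iso_eq/gorbit_eq.
Qed.

Lemma orbit_class_map X Y (f : X -> Y) (O : set X) :
  injective f -> equivariant f -> gorbits X O ->
  orbit_class (f @` O) = orbit_class O.
Proof.
move=> fI fG [x _ <-]; rewrite -gorbit_map // !orbit_class_gorbit.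
by congr (bgen (iclass _)); apply: smooth_subgroup_eq; exact: stab_inj.
Qed.

Lemma gclass_map X Y (f : X -> Y) : injective f -> equivariant f ->
  \sum_(O \in [set f @` O | O in gorbits X]) orbit_class O = gclass X.
Proof.
move=> fI fG; rewrite fsbig_image.
  by apply: eq_fsbigr => O; rewrite inE => OX; exact: orbit_class_map.
move=> O O' _ _ e; apply/seteqP; split => x Ox.
  have : (f @` O) (f x) by exists x.
  by rewrite e => -[y O'y /fI <-].
have : (f @` O') (f x) by exists x.
by rewrite -e => -[y O'y /fI <-].
Qed.

Lemma gclass_iso X Y : gset_iso X Y -> gclass X = gclass Y.
Proof.
move=> [f [[h fK hK] fG]]; rewrite -(gclass_map (can_inj fK) fG).
rewrite /gclass (gorbits_iso fG) // => y; exists (h y); by rewrite hK.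
Qed.

Lemma gclass_sum X Y : gclass (ssum X Y) = gclass X + gclass Y.
Proof.
have lG : @equivariant _ X (ssum X Y) inl by [].
have rG : @equivariant _ Y (ssum X Y) inr by [].
rewrite -(@gclass_map X (ssum X Y) _ inl_inj lG) -(@gclass_map Y (ssum X Y) _ inr_inj rG).
rewrite /gclass gorbits_sum fsbigU0 //.
- by apply: finite_image; exact: sg_fin.
- by apply: finite_image; exact: sg_fin.
- move=> _ [[_ [x _ <-] <-] [_ [y _ <-]]] /seteqP [e _].
  have [|? _ //] := e (inr y); exists y => //; exact: gorbit_refl.
Qed.

Lemma gclass_empty : gclass (sempty P) = 0.
Proof. by apply: fsbig1 => _ [[]]. Qed.

Lemma gclass_transitive X (x0 : X) :
  (forall y : X, exists g, y = gact g x0) -> gclass X = bgen (iclass (sstab x0)).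
Proof.
by move=> tr; rewrite /gclass (gtransitive_orbits tr) fsbig_set1 orbit_class_gorbit.
Qed.

Lemma gclass_coset (U : smooth_subgroup P) : gclass (scoset U) = bgen (iclass U).
Proof.
have [x0 tr] := coset_transitive (ssub U).
rewrite (@gclass_transitive (scoset U) x0 tr); congr bgen.
apply/iclass_eq; apply: gset_iso_sym; exact: gcoset_iso.
Qed.

Lemma gsub_smooth X (A : set X) (AG : ginvariant A) : smooth (pset P) (gsub AG).
Proof.
move=> [x Ax]; have [B [fB eB]] := sg_smooth x; exists B; split => //.
rewrite -eB; apply/seteqP; split => [g /(congr1 sval)//|g e]; exact: eq_exist.
Qed.

Lemma gsub_fin X (A : set X) (AG : ginvariant A) : fin_orbits (gsub AG).
Proof.
apply: sub_finite_set
  (finite_image (fun O : set X => [set y : gsub AG | O (sval y)]) (sg_fin X)).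
move=> _ [[x Ax] _ <-]; exists (gorbit x); first by exists x.
apply/seteqP; split => [[y Ay] /= [g e]|_ [g ->]]; last by exists g.
by exists g; apply: eq_exist.
Qed.

Definition ssubset X (A : set X) (AG : ginvariant A) : sgset P :=
  SGset (@gsub_smooth X A AG) (@gsub_fin X A AG).

Lemma sgset_ind (K : sgset P -> Prop) :
  (forall X Y, gset_iso X Y -> K X -> K Y) ->
  K (sempty P) ->
  (forall U X, K X -> K (ssum (scoset U) X)) ->
  forall X, K X.
Proof.
move=> Ki K0 KS X; have [n [r rP]] := fin_orbits_reps (sg_fin X).
elim: n => [|n IHn] in X r rP *.
  apply: Ki K0; exists (False_rect _); split; last by move=> g [].
  have nX (x : X) : False by have [i _] := rP x; have := ltn_ord i.
  by exists nX => [[]|x]; case: (nX x).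
pose A : set X := ~` gorbit (r ord0).
have AG : ginvariant A.
  move=> g x Ax [h e]; apply: Ax; exists (g^-1 * h)%g.
  by rewrite gactM -e gactK.
have KA : K (ssubset AG).
  have [[y0]|nA] := pselect (exists y : ssubset AG, True); last first.
    apply: Ki K0; exists (False_rect _); split; last by move=> g [].
    have nX (x : ssubset AG) : False by apply: nA; exists x.
    by exists nX => [[]|x]; case: (nX x).
  move=> _; pose r' i : ssubset AG := if pselect (A (r (fintype.lift ord0 i))) is left Ai
    then exist _ _ Ai else y0.
  apply: (IHn _ r') => -[x Ax]; have [i [g e]] := rP x.
  have [i0|/unlift_some[j ej _]] := eqVneq ord0 i.
    by case: Ax; exists g; rewrite i0.
  have Aj : A (r (fintype.lift ord0 j)).
    by move: (AG g^-1%g x Ax); rewrite e gactK ej.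
  exists j, g; rewrite /r'; case: pselect => // {}Aj.
  by apply: eq_exist; rewrite e ej.
apply: Ki (KS (sstab (r ord0)) _ KA).
have i1 : gset_iso (coset_gset (stab (r ord0))) (gorbit_gset (r ord0)).
  apply: gset_iso_sym.
  have := @gcoset_iso _ (gorbit_gset (r ord0)) (exist _ _ (gorbit_refl (r ord0))).
  have -> : stab (exist _ _ (gorbit_refl (r ord0)) : gorbit_gset (r ord0)) = stab (r ord0).
    apply/seteqP; split => [g /(congr1 sval)//|g e]; exact: eq_exist.
  by apply => -[w [g e]]; exists g; exact: eq_exist.
have [f [bf fG]] := i1.
pose F (z : ssum (scoset (sstab (r ord0))) (ssubset AG)) : X :=
  match z with inl c => sval (f c) | inr a => sval a end.
apply: (@gset_iso_bij _ _ _ F).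
- move=> [c|[a Aa]] [c'|[a' Aa']] /= e.
  + congr inl; apply: (bij_inj bf); case: (f c) (f c') e => [? ?] [? ?] /= e.
    exact: eq_exist.
  + by case: Aa'; rewrite -e; case: (f c).
  + by case: Aa; rewrite e; case: (f c').
  + by congr inr; exact: eq_exist.
- move=> x; have [Ox|nOx] := pselect (gorbit (r ord0) x).
    have [h _ hK] := bf; exists (inl (h (exist _ x Ox))).
    by rewrite /F hK.
  by exists (inr (exist _ x nOx)).
- by move=> g [c|a] //=; rewrite fG.
Qed.

Lemma burnside_ind (K : burnside P -> Prop) :
  (forall U, K (gclass (scoset U))) -> (forall a b, K a -> K b -> K (a - b)) ->
  K 0 -> forall a, K a.
Proof.
move=> KU KB K0.
have KN a : K a -> K (- a) by rewrite -(sub0r a); exact: KB.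
have KD a b : K a -> K b -> K (a + b) by move=> Ka /KN; rewrite -{2}(opprK b); exact: KB.
move=> a; rewrite -(freeg_sumE a); elim/big_ind: _ => // c _.
rewrite -[coeff _ _]intz -freegU_mulz.
have Kc : K (bgen c) by rewrite -(ireprK c) -gclass_coset.
have Kn n : K (bgen c *+ n) by elim: n => [|n IHn]; rewrite ?mulr0n ?mulrS //; exact: KD.
by case: (coeff c a) => n; [exact: Kn | apply: KN; exact: Kn].
Qed.

Lemma gclass_eq (M : zmodType) (K K' : burnside P -> M) :
  {morph K : a b / a - b} -> {morph K' : a b / a - b} ->
  (forall U, K (gclass (scoset U)) = K' (gclass (scoset U))) -> forall a, K a = K' a.
Proof.
move=> KB K'B e; apply: burnside_ind => [U|a b ea eb|]; first exact: e.
  by rewrite KB K'B ea eb.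
by rewrite -(subrr 0) KB K'B !subrr.
Qed.

Lemma fglift_bgen (M : lmodType int) (f : isoclass P -> M) c :
  fglift f (bgen c) = f c.
Proof. by rewrite /bgen liftU scale1r. Qed.

Lemma fgliftB (M : lmodType int) (f : isoclass P -> M) :
  {morph fglift f : a b / a - b}.
Proof. exact: lift_is_additive. Qed.

Lemma gclass_lift (M : lmodType int) (f : isoclass P -> M) (phi : sgset P -> M) :
  (forall X Y, gset_iso X Y -> phi X = phi Y) ->
  phi (sempty P) = 0 ->
  (forall X Y, phi (ssum X Y) = phi X + phi Y) ->
  (forall c, f c = phi (scoset (irepr c))) ->
  forall X, fglift f (gclass X) = phi X.
Proof.
move=> phi_iso phi0 phiD fE; apply: sgset_ind => [X Y i IHX||U X IHX].
- by rewrite -(phi_iso _ _ i) -(gclass_iso i).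
- by rewrite gclass_empty phi0 -(subrr 0) fgliftB subrr.
have fglD a b : fglift f (a + b) = fglift f a + fglift f b.
  have fgl0 : fglift f 0 = 0 by rewrite -(subrr 0) fgliftB subrr.
  by rewrite -{1}(opprK b) fgliftB -[- b]sub0r fgliftB fgl0 sub0r opprK.
rewrite gclass_sum fglD IHX phiD gclass_coset fglift_bgen fE; congr (_ + _).
by apply: phi_iso; apply/iclass_eq; exact: ireprK.
Qed.

(* The bilinear extension of [G/U] * [G/U'] = [G/U x G/U']; see [gclassM] for
   arbitrary smooth G-sets with finitely many orbits. *)
Definition bmul (a b : burnside P) : burnside P :=
  fglift (fun c => fglift (fun d =>
    gclass (sprod (scoset (irepr c)) (scoset (irepr d)))) b) a.

Lemma sprodDl X Y Z :
  gclass (sprod (ssum X Y) Z) = gclass (sprod X Z) + gclass (sprod Y Z).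
Proof. by rewrite -gclass_sum; apply: gclass_iso; exact: gprod_sum_iso. Qed.

Lemma sprodC X Y : gclass (sprod X Y) = gclass (sprod Y X).
Proof. by apply: gclass_iso; exact: gprodC_iso. Qed.

Lemma sprodDr X Y Z :
  gclass (sprod Z (ssum X Y)) = gclass (sprod Z X) + gclass (sprod Z Y).
Proof. by rewrite sprodC sprodDl !(sprodC Z). Qed.

Lemma sprod0l X : gclass (sprod (sempty P) X) = 0.
Proof. by rewrite -(gclass_empty); apply: gclass_iso; exact: gprod0_iso. Qed.

Lemma bmul_gclass X Y : bmul (gclass X) (gclass Y) = gclass (sprod X Y).
Proof.
apply: (@gclass_lift _ _ (fun X => gclass (sprod X Y))) => [X1 X2 i|||c].
- by apply: gclass_iso; apply: gprod_iso => //; exact: gset_iso_refl.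
- exact: sprod0l.
- by move=> X1 X2; exact: sprodDl.
apply: (@gclass_lift _ _ (fun Y => gclass (sprod (scoset (irepr c)) Y)))
  => [Y1 Y2 i|||//].
- by apply: gclass_iso; apply: gprod_iso => //; exact: gset_iso_refl.
- by rewrite sprodC sprod0l.
- by move=> Y1 Y2; exact: sprodDr.
Qed.

Lemma bmulBl c : {morph bmul^~ c : a b / a - b}.
Proof. exact: fgliftB. Qed.

Lemma bmulBr c : {morph bmul c : a b / a - b}.
Proof.
move=> a b.
apply: (@gclass_eq _ (bmul^~ (a - b)) (fun c => bmul c a - bmul c b)) => [|c1 c2|U].
- exact: bmulBl.
- by rewrite !bmulBl !opprD !opprK addrACA.
- by rewrite gclass_coset /bmul !fglift_bgen fgliftB.
Qed.

Lemma bmulC : commutative bmul.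
Proof.
move=> a b; apply: (@gclass_eq _ (bmul^~ b) (bmul b)) => [||U]; [exact: bmulBl|exact: bmulBr|].
apply: (@gclass_eq _ (bmul _) (bmul^~ _)) => [||U']; [exact: bmulBr|exact: bmulBl|].
by rewrite !bmul_gclass sprodC.
Qed.

Lemma bmulA : associative bmul.
Proof.
move=> a b c.
apply: (@gclass_eq _ (bmul^~ (bmul b c)) (fun a => bmul (bmul a b) c)) => [|x y|U].
- exact: bmulBl.
- by rewrite !bmulBl.
apply: (@gclass_eq _ (fun b => bmul _ (bmul b c)) (fun b => bmul (bmul _ b) c)) => [x y|x y|U'].
- by rewrite bmulBl bmulBr.
- by rewrite bmulBr bmulBl.
apply: (@gclass_eq _ (fun c => bmul _ (bmul _ c)) (fun c => bmul _ c)) => [x y|x y|U''].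
- by rewrite !bmulBr.
- by rewrite bmulBr.
by rewrite !bmul_gclass; apply: gclass_iso; exact: gprodA_iso.
Qed.

Definition bone : burnside P := gclass (spoint P).

Lemma bmul1 : left_id bone bmul.
Proof.
apply: (@gclass_eq _ (bmul bone) id) => [||U] //; first exact: bmulBr.
by rewrite bmul_gclass; apply: gclass_iso; exact: gprod1_iso.
Qed.

Lemma bmulDl : left_distributive bmul +%R.
Proof.
move=> a b c; rewrite -{1}(opprK b) bmulBl -[- b]sub0r bmulBl.
have -> : bmul 0 c = 0 by have := bmulBl c 0 0; rewrite !subrr.
by rewrite sub0r opprK.
Qed.

Lemma bone_neq0 : bone != 0.
Proof.
rewrite /bone (@gclass_transitive (spoint P) tt) => [|[]]; last by exists 1%g.
by rewrite /bgen freegU_eq0.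
Qed.

HB.instance Definition _ := GRing.Zmodule_isComNzRing.Build (burnside P)
  bmulA bmulC bmul1 bmulDl bone_neq0.

Lemma gclassM X Y : gclass X * gclass Y = gclass (sprod X Y).
Proof. exact: bmul_gclass. Qed.

End Class.

Section Pullback.
Variables (P Q : opair) (h : pair_hom P Q).

(* The additive extension of [G/U] |-> [h^* (G/U)]; see [bpull_gclass]. *)
Definition bpull (a : burnside Q) : burnside P :=
  fglift (fun c => gclass (spull h (scoset (irepr c)))) a.

Lemma bpull_gclass (X : sgset Q) : bpull (gclass X) = gclass (spull h X).
Proof.
apply: (@gclass_lift _ _ _ (fun X => gclass (spull h X))) => [X1 X2 i||X1 X2|//].
- apply: gclass_iso; have [f [bf fG]] := i; exists f; split => // g x; exact: fG.
- by apply: fsbig1 => _ [[]].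
- rewrite -gclass_sum; apply: gclass_iso; exists id; split; first by exists id.
  by move=> g [x|x].
Qed.

Lemma bpullB : {morph bpull : a b / a - b}.
Proof. exact: fgliftB. Qed.

Lemma bpull_monoid : GRing.monoid_morphism bpull.
Proof.
split=> [|a b].
  by rewrite [LHS]bpull_gclass; apply: gclass_iso; exists id; split=> //; exists id.
apply: (@gclass_eq _ _ (fun a => bpull (a * b)) (fun a => bpull a * bpull b))
  => [x y|x y|U].
- by rewrite mulrBl bpullB.
- by rewrite bpullB mulrBl.
apply: (@gclass_eq _ _ (fun b => bpull (_ * b)) (fun b => bpull _ * bpull b))
  => [x y|x y|U'].
- by rewrite mulrBr bpullB.
- by rewrite bpullB mulrBr.
rewrite gclassM !bpull_gclass gclassM; apply: gclass_iso.
by exists id; split=> //; exists id.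
Qed.

HB.instance Definition _ := GRing.isZmodMorphism.Build _ _ bpull bpullB.
HB.instance Definition _ := GRing.isMonoidMorphism.Build _ _ bpull bpull_monoid.

End Pullback.

Section Localization.
Variables (R : comNzRingType) (q : nat).

Definition loc_rel (x y : R * nat) : bool :=
  `[< exists k, q%:R ^+ (k + y.2) * x.1 = q%:R ^+ (k + x.2) * y.1 >].

Lemma loc_rel_refl : reflexive loc_rel.
Proof. by move=> x; apply/asboolP; exists 0. Qed.

Lemma loc_rel_sym : symmetric loc_rel.
Proof. by move=> x y; apply/asboolP/asboolP => -[k e]; exists k. Qed.

Lemma loc_rel_trans : transitive loc_rel.
Proof.
move=> [b n] [a m] [c p] /asboolP[k /= e1] /asboolP[l /= e2].
apply/asboolP; exists (k + l + n)%N => /=.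
have -> : q%:R ^+ (k + l + n + p) * a = q%:R ^+ (l + p) * (q%:R ^+ (k + n) * a).
  by rewrite mulrA -exprD; congr (_ ^+ _ * _); ring.
have -> : q%:R ^+ (k + l + n + m) * c = q%:R ^+ (k + m) * (q%:R ^+ (l + n) * c).
  by rewrite mulrA -exprD; congr (_ ^+ _ * _); ring.
by rewrite e1 -e2 !mulrA -!exprD addnC.
Qed.

Canonical loc_rel_equiv :=
  EquivRel loc_rel loc_rel_refl loc_rel_sym loc_rel_trans.

(* The localization R[1/q], with [frac a n] standing for a / q^n. *)
Definition localized := {eq_quot loc_rel_equiv}.
HB.instance Definition _ := Choice.on localized.
HB.instance Definition _ := EqQuotient.on localized.

Definition frac (a : R) (n : nat) : localized := \pi_localized (a, n).

Lemma fracP (x : localized) : exists a n, x = frac a n.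
Proof. by elim/quotW: x => -[a n]; exists a, n. Qed.

Lemma frac_eq a m b n : frac a m = frac b n <->
  exists k, q%:R ^+ (k + n) * a = q%:R ^+ (k + m) * b.
Proof. by split => [/eqmodP/asboolP//|e]; exact/eqmodP/asboolP. Qed.

Definition lnum (x : localized) : R := (repr x).1.
Definition lexp (x : localized) : nat := (repr x).2.

Lemma lnumK x : frac (lnum x) (lexp x) = x.
Proof. by rewrite /frac -surjective_pairing reprK. Qed.

Definition ladd x y :=
  frac (q%:R ^+ lexp y * lnum x + q%:R ^+ lexp x * lnum y) (lexp x + lexp y).
Definition lopp x := frac (- lnum x) (lexp x).
Definition lmul x y := frac (lnum x * lnum y) (lexp x + lexp y).

Lemma frac_repr a m :
  exists k, q%:R ^+ (k + m) * lnum (frac a m) = q%:R ^+ (k + lexp (frac a m)) * a.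
Proof. by apply/frac_eq; exact: lnumK. Qed.

Lemma ladd_frac a m b n :
  ladd (frac a m) (frac b n) = frac (q%:R ^+ n * a + q%:R ^+ m * b) (m + n).
Proof.
have [k] := frac_repr a m; have [l] := frac_repr b n; rewrite /ladd.
move: (lnum (frac a m)) (lexp (frac a m)) => a' m'.
move: (lnum (frac b n)) (lexp (frac b n)) => b' n' e2 e1.
apply/frac_eq; exists (k + l)%N.
have -> : q%:R ^+ (k + l + (m + n)) * (q%:R ^+ n' * a' + q%:R ^+ m' * b') =
  q%:R ^+ (l + n + n') * (q%:R ^+ (k + m) * a') +
  q%:R ^+ (k + m + m') * (q%:R ^+ (l + n) * b') :> R.
  by rewrite !exprD; ring.
by rewrite e1 e2 !exprD; ring.
Qed.

Lemma lopp_frac a m : lopp (frac a m) = frac (- a) m.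
Proof.
have [k e] := frac_repr a m; apply/frac_eq; exists k.
by rewrite !mulrN e.
Qed.

Lemma lmul_frac a m b n : lmul (frac a m) (frac b n) = frac (a * b) (m + n).
Proof.
have [k] := frac_repr a m; have [l] := frac_repr b n; rewrite /lmul.
move: (lnum (frac a m)) (lexp (frac a m)) => a' m'.
move: (lnum (frac b n)) (lexp (frac b n)) => b' n' e2 e1.
apply/frac_eq; exists (k + l)%N.
have -> : q%:R ^+ (k + l + (m + n)) * (a' * b') =
  (q%:R ^+ (k + m) * a') * (q%:R ^+ (l + n) * b') :> R by rewrite !exprD; ring.
by rewrite e1 e2 !exprD; ring.
Qed.

Lemma frac_eq1 a m b n : q%:R ^+ n * a = q%:R ^+ m * b -> frac a m = frac b n.
Proof. by move=> e; apply/frac_eq; exists 0. Qed.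

Lemma laddA : associative ladd.
Proof.
move=> x y z; have [a [m ->]] := fracP x; have [b [n ->]] := fracP y.
have [c [p ->]] := fracP z; rewrite !ladd_frac; apply: frac_eq1.
by rewrite !exprD; ring.
Qed.

Lemma laddC : commutative ladd.
Proof.
move=> x y; have [a [m ->]] := fracP x; have [b [n ->]] := fracP y.
by rewrite !ladd_frac; apply: frac_eq1; rewrite !exprD; ring.
Qed.

Lemma ladd0 : left_id (frac 0 0) ladd.
Proof.
move=> x; have [a [m ->]] := fracP x; rewrite ladd_frac; apply: frac_eq1.
by rewrite add0n expr0; ring.
Qed.

Lemma laddN : left_inverse (frac 0 0) lopp ladd.
Proof.
move=> x; have [a [m ->]] := fracP x; rewrite lopp_frac ladd_frac.
by apply: frac_eq1; ring.
Qed.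

HB.instance Definition _ := GRing.isZmodule.Build localized laddA laddC ladd0 laddN.

Lemma fracD a m b n :
  frac a m + frac b n = frac (q%:R ^+ n * a + q%:R ^+ m * b) (m + n).
Proof. exact: ladd_frac. Qed.

Lemma fracN a m : - frac a m = frac (- a) m.
Proof. exact: lopp_frac. Qed.

Lemma lmulA : associative lmul.
Proof.
move=> x y z; have [a [m ->]] := fracP x; have [b [n ->]] := fracP y.
have [c [p ->]] := fracP z; rewrite !lmul_frac; apply: frac_eq1.
by rewrite !exprD; ring.
Qed.

Lemma lmulC : commutative lmul.
Proof.
move=> x y; have [a [m ->]] := fracP x; have [b [n ->]] := fracP y.
by rewrite !lmul_frac; apply: frac_eq1; rewrite !exprD; ring.
Qed.

Lemma lmul1 : left_id (frac 1 0) lmul.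
Proof.
by move=> x; have [a [m ->]] := fracP x; rewrite lmul_frac mul1r.
Qed.

Lemma lmulDl : left_distributive lmul +%R.
Proof.
move=> x y z; have [a [m ->]] := fracP x; have [b [n ->]] := fracP y.
have [c [p ->]] := fracP z; rewrite fracD !lmul_frac fracD.
by apply: frac_eq1; rewrite !exprD; ring.
Qed.

HB.instance Definition _ :=
  GRing.Zmodule_isComPzRing.Build localized lmulA lmulC lmul1 lmulDl.

Lemma fracM a m b n : frac a m * frac b n = frac (a * b) (m + n).
Proof. exact: lmul_frac. Qed.

End Localization.

Section LocalizedMap.
Variables (R S : comNzRingType) (f : {rmorphism R -> S}) (q : nat).

Definition localized_map (x : localized R q) : localized S q :=
  frac q (f (lnum x)) (lexp x).

Lemma localized_map_frac a n : localized_map (frac q a n) = frac q (f a) n.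
Proof.
have [k e] := frac_repr q a n; apply/frac_eq; exists k.
by have := congr1 f e; rewrite !rmorphM !rmorphXn !rmorph_nat.
Qed.

Lemma localized_map_zmod : GRing.zmod_morphism localized_map.
Proof.
move=> x y; have [a [m ->]] := fracP x; have [b [n ->]] := fracP y.
rewrite fracN fracD !localized_map_frac fracN fracD; congr (frac _ _ _).
by rewrite rmorphD !rmorphM !rmorphXn !rmorph_nat rmorphN.
Qed.

Lemma localized_map_monoid : GRing.monoid_morphism localized_map.
Proof.
split=> [|x y]; first by rewrite [LHS]localized_map_frac rmorph1.
have [a [m ->]] := fracP x; have [b [n ->]] := fracP y.
by rewrite fracM !localized_map_frac fracM rmorphM.
Qed.

HB.instance Definition _ := GRing.isZmodMorphism.Build _ _ localized_map localized_map_zmod.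
HB.instance Definition _ := GRing.isMonoidMorphism.Build _ _ localized_map localized_map_monoid.
End LocalizedMap.
Arguments localized_map {R S} f q x.

Lemma fin_orbits_gpull (G H : groupType) (h : G -> H)
    (hM : {morph h : x y / (x * y)%g}) (X : gset H) :
  fin_orbits (gpull hM X) -> fin_orbits X.
Proof.
move=> /fin_orbits_reps [n [r rP]]; apply: (@fin_orbits_cover _ X n r) => x.
by have [i [g ->]] := rP x; exists i, (h g).
Qed.

(* A pair of polynomials carries the coordinates of a vector on the basis
   (e_i)_i, (f_i)_i, as the coefficients of the two components.  Indices start
   at 0, so [evec 0] and [fvec 0] are the vectors written e_1 and f_1. *)
Definition spV (F : finFieldType) := ({poly F} * {poly F})%type.
HB.instance Definition _ F := GRing.Lmodule.on (spV F).

Section Space.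
Variable F : finFieldType.
Implicit Types u v w : spV F.

Definition evec (i : nat) : spV F := ('X^i, 0).
Definition fvec (i : nat) : spV F := (0, 'X^i).

Definition spform u v : F :=
  \sum_(i < maxn (size u.1) (size u.2)) (u.1`_i * v.2`_i - u.2`_i * v.1`_i).

Lemma spformE n u v : (size u.1 <= n)%N -> (size u.2 <= n)%N ->
  spform u v = \sum_(i < n) (u.1`_i * v.2`_i - u.2`_i * v.1`_i).
Proof.
move=> u1 u2; rewrite /spform; set k := maxn _ _.
have kn : (k <= n)%N by rewrite geq_max u1.
rewrite (big_ord_widen n (fun i => u.1`_i * v.2`_i - u.2`_i * v.1`_i) kn).
rewrite big_mkcond /=; apply: eq_bigr => i _; case: ltnP => // ki.
move: ki; rewrite geq_max => /andP[i1 i2].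
by rewrite (nth_default _ i1) (nth_default _ i2) !mul0r subrr.
Qed.

Lemma spform_bound u v n : exists2 m, (n <= m)%N &
  [/\ (size u.1 <= m)%N, (size u.2 <= m)%N, (size v.1 <= m)%N & (size v.2 <= m)%N].
Proof.
by exists (n + size u.1 + size u.2 + size v.1 + size v.2)%N; [|split]; lia.
Qed.

Lemma spformDl u v w : spform (u + v) w = spform u w + spform v w.
Proof.
have [m _ [u1 u2 v1 v2]] := spform_bound u v 0.
rewrite !(@spformE m) //= ?(leq_trans (size_polyD _ _)) ?geq_max ?u1 ?u2 //.
by rewrite -big_split /=; apply: eq_bigr => i _; rewrite !coefD; ring.
Qed.

Lemma spformZl a u v : spform (a *: u) v = a * spform u v.
Proof.
have [m _ [u1 u2 _ _]] := spform_bound u u 0.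
rewrite !(@spformE m) //= ?(leq_trans (size_scale_leq _ _)) //.
by rewrite big_distrr /=; apply: eq_bigr => i _; rewrite !coefZ; ring.
Qed.

Lemma spformC u v : spform v u = - spform u v.
Proof.
have [m _ [u1 u2 v1 v2]] := spform_bound u v 0.
by rewrite !(@spformE m) // -sumrN; apply: eq_bigr => i _; ring.
Qed.

Lemma spform_alt u : spform u u = 0.
Proof. by rewrite /spform big1 // => i _; ring. Qed.

Lemma spformDr u v w : spform w (u + v) = spform w u + spform w v.
Proof. by rewrite !(spformC _ w) spformDl opprD. Qed.

Lemma spformZr a u v : spform v (a *: u) = a * spform v u.
Proof. by rewrite !(spformC _ v) spformZl mulrN. Qed.

Lemma spformNl u v : spform (- u) v = - spform u v.
Proof. by rewrite -scaleN1r spformZl mulN1r. Qed.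

Lemma spformNr u v : spform v (- u) = - spform v u.
Proof. by rewrite -scaleN1r spformZr mulN1r. Qed.

Lemma spform_e i v : spform (evec i) v = v.2`_i.
Proof.
rewrite (@spformE i.+1) /= ?size_polyXn ?size_poly0 //.
rewrite big_ord_recr /= big1 => [|j _]; rewrite coefXn coef0.
  by rewrite eqxx mul1r mul0r subr0 add0r.
by rewrite ltn_eqF // !mul0r subrr.
Qed.

Lemma spform_f i v : spform (fvec i) v = - v.1`_i.
Proof.
rewrite (@spformE i.+1) /= ?size_polyXn ?size_poly0 //.
rewrite big_ord_recr /= big1 => [|j _]; rewrite coefXn coef0.
  by rewrite eqxx mul1r mul0r sub0r add0r.
by rewrite ltn_eqF // !mul0r subrr.
Qed.

Lemma spform_ee i j : spform (evec i) (evec j) = 0.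
Proof. by rewrite spform_e coef0. Qed.

Lemma spform_ff i j : spform (fvec i) (fvec j) = 0.
Proof. by rewrite spform_f coef0 oppr0. Qed.

Lemma spform_ef i j : spform (evec i) (fvec j) = (i == j)%:R.
Proof. by rewrite spform_e coefXn. Qed.

Record sp := Sp {
  sp_fun :> spV F -> spV F;
  sp_linear : linear sp_fun;
  sp_bij : bijective sp_fun;
  sp_isom : forall u v, spform (sp_fun u) (sp_fun v) = spform u v }.

Lemma sp_eq (g h : sp) : g =1 h -> g = h.
Proof.
case: g h => [g ? ? ?] [h ? ? ?] /= /funext e; move: e => e; subst h.
by congr Sp; exact: Prop_irrelevance.
Qed.

HB.instance Definition _ := gen_eqMixin sp.
HB.instance Definition _ := gen_choiceMixin sp.

Definition sp1 : sp.
Proof. by exists id => //; exists id. Defined.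

Definition spM (g h : sp) : sp.
Proof.
exists (g \o h) => [a u v||u v] /=; first by rewrite !sp_linear.
  by apply: bij_comp; exact: sp_bij.
by rewrite !sp_isom.
Defined.

Lemma sp_inv_subproof (g : sp) : exists h : sp, cancel g h /\ cancel h g.
Proof.
have [h gK hK] := sp_bij g.
have hl : linear h by move=> a u v; apply: (can_inj gK); rewrite sp_linear !hK.
have hi u v : spform (h u) (h v) = spform u v by rewrite -(sp_isom g) !hK.
by exists (Sp hl (Bijective hK gK) hi).
Qed.

Definition spinv (g : sp) : sp := projT1 (cid (sp_inv_subproof g)).

Lemma spinvK (g : sp) : cancel g (spinv g).
Proof. by rewrite /spinv; case: cid => h []. Qed.
Lemma spinvVK (g : sp) : cancel (spinv g) g.
Proof. by rewrite /spinv; case: cid => h []. Qed.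

Lemma spMA : associative spM. Proof. by move=> g h k; exact: sp_eq. Qed.
Lemma sp1M : left_id sp1 spM. Proof. by move=> g; exact: sp_eq. Qed.
Lemma spM1 : right_id sp1 spM. Proof. by move=> g; exact: sp_eq. Qed.
Lemma spVM : left_inverse sp1 spinv spM.
Proof. by move=> g; apply: sp_eq; exact: spinvK. Qed.
Lemma spMV : right_inverse sp1 spinv spM.
Proof. by move=> g; apply: sp_eq; exact: spinvVK. Qed.

HB.instance Definition _ := isGroup.Build sp spMA sp1M spM1 spVM spMV.

Definition sp_gset : gset sp :=
  @GSet sp (spV F) (fun g v => g v) (fun _ => erefl) (fun _ _ _ => erefl).

Lemma spD (g : sp) u v : g (u + v) = g u + g v.
Proof. by have := sp_linear g 1 u v; rewrite !scale1r. Qed.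

Lemma sp0 (g : sp) : g 0 = 0.
Proof. by apply: (addrI (g 0)); rewrite -spD !addr0. Qed.

Lemma spZ (g : sp) a u : g (a *: u) = a *: g u.
Proof. by have := sp_linear g a u 0; rewrite !addr0 sp0 addr0. Qed.

Definition tvfun (a : spV F) (c : F) v : spV F := v + (c * spform v a) *: a.

Lemma tvfunK a c : cancel (tvfun a c) (tvfun a (- c)).
Proof.
move=> v; rewrite /tvfun spformDl spformZl spform_alt mulr0 addr0 mulNr.
by rewrite scaleNr addrK.
Qed.

Definition transvection (a : spV F) (c : F) : sp.
Proof.
exists (tvfun a c) => [b u v||u v].
- rewrite /tvfun spformDl spformZl mulrDr scalerDl !scalerDr !scalerA mulrCA.
  by rewrite addrACA.
- exists (tvfun a (- c)); first exact: tvfunK.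
  by move=> v; rewrite -{1}(opprK c); exact: tvfunK.
- rewrite /tvfun !(spformDl, spformDr, spformZl, spformZr) spform_alt.
  by rewrite (spformC v a); ring.
Defined.

Definition low n v := (size v.1 <= n)%N /\ (size v.2 <= n)%N.
Definition high n v := forall i, (i < n)%N -> v.1`_i = 0 /\ v.2`_i = 0.

Lemma low_high n u v : low n u -> high n v -> spform u v = 0.
Proof.
move=> [u1 u2] hv; rewrite (spformE _ u1 u2) big1 // => i _.
by have [-> ->] := hv i (ltn_ord i); ring.
Qed.

Lemma low_high_split n v : exists u w, [/\ v = u + w, low n u & high n w].
Proof.
exists (take_poly n v.1, take_poly n v.2).
exists (drop_poly n v.1 * 'X^n, drop_poly n v.2 * 'X^n); split => //=.
- by case: v => v1 v2; congr (_, _); rewrite /= poly_take_drop.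
- by split; exact: size_take_poly.
- by move=> i iltn; rewrite /= !coefMXn iltn.
Qed.

Lemma nz_pair n u : high n u -> u != 0 -> exists2 b, high n b & spform u b != 0.
Proof.
move=> hu u0; have [i ui] : exists i, (u.1`_i != 0) \/ (u.2`_i != 0).
  apply/not_existsP => e; case/eqP: u0; case: u e {hu} => u1 u2 e.
  by congr (_, _); apply/polyP => i; rewrite coef0; apply: contra_notP (e i) => /eqP;
    [left|right].
have ni : (n <= i)%N.
  by rewrite leqNgt; apply/negP => /hu [e1 e2]; case: ui; rewrite ?e1 ?e2 eqxx.
have hX j : (j < n)%N -> ('X^i : {poly F})`_j = 0.
  by move=> jn; rewrite coefXn ltn_eqF // (leq_trans jn).
case: ui => ui.
  by exists (fvec i) => [j jn|]; rewrite ?hX ?coef0 // spformC spform_f opprK.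
by exists (evec i) => [j jn|]; rewrite ?hX ?coef0 // spformC spform_e oppr_eq0.
Qed.

Lemma highD n u v : high n u -> high n v -> high n (u + v).
Proof.
move=> hu hv i iltn; have [e1 e2] := hu i iltn; have [e3 e4] := hv i iltn.
by rewrite /= !coefD e1 e2 e3 e4 !addr0.
Qed.

Lemma highN n u : high n u -> high n (- u).
Proof.
by move=> hu i iltn; have [e1 e2] := hu i iltn; rewrite /= !coefN e1 e2 !oppr0.
Qed.

Lemma move1 n u v : high n u -> high n v -> spform u v != 0 ->
  exists g : sp, g u = v /\ forall w, low n w -> g w = w.
Proof.
move=> hu hv uv; exists (transvection (v - u) (spform u v)^-1); split.
  rewrite /= /tvfun spformDr spformNr spform_alt subr0 mulVf // scale1r.
  by rewrite addrC subrK.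
move=> w lw; rewrite /= /tvfun (low_high lw) ?mulr0 ?scale0r ?addr0 //.
by apply: highD => //; exact: highN.
Qed.

Lemma move2 n u v : high n u -> high n v -> u != 0 -> v != 0 ->
  exists g : sp, g u = v /\ forall w, low n w -> g w = w.
Proof.
move=> hu hv u0 v0; have [uv|] := eqVneq (spform u v) 0; last exact: move1.
have [b hb ub] := nz_pair hu u0; have [b' hb' vb'] := nz_pair hv v0.
have [w [hw uw wv]] : exists w, [/\ high n w, spform u w != 0 & spform w v != 0].
  have [ub'|ub'] := eqVneq (spform u b') 0; last first.
    by exists b'; split => //; rewrite spformC oppr_eq0.
  have [bv|bv] := eqVneq (spform b v) 0; last by exists b.
  exists (b + b'); split; first exact: highD.
    by rewrite spformDr ub' addr0.
  by rewrite spformDl bv add0r spformC oppr_eq0.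
have [g [gu gl]] := move1 hu hw uw; have [h [hw' hl]] := move1 hw hv wv.
by exists (h * g)%g; split => [|z lz] /=; rewrite ?gu // gl // hl.
Qed.

Lemma lowS n u : low n u -> low n.+1 u.
Proof. by case=> ? ?; split; exact: leqW. Qed.

Lemma move_low n (s : nat -> spV F) :
  exists g : sp, forall i, (i < n)%N -> low n (g (s i)).
Proof.
elim: n => [|n [g gP]]; first by exists 1%g.
have [u [w [e lu hw]]] := low_high_split n (g (s n)).
have [w0|w0] := eqVneq w 0.
  exists g => i; rewrite ltnS leq_eqVlt => /predU1P[->|/gP]; last exact: lowS.
  by rewrite e w0 addr0; exact: lowS.
have he : high n (evec n).
  by move=> i iltn; rewrite /= coef0 coefXn ltn_eqF.
have e0 : evec n != 0.
  by apply/eqP => /(congr1 fst) /= /eqP; rewrite -size_poly_eq0 size_polyXn.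
have [h [hE hl]] := move2 hw he w0 e0.
exists (h * g)%g => i; rewrite ltnS leq_eqVlt => /predU1P[->|iltn].
  rewrite /= e spD hE hl //; case: (lowS lu) => l1 l2; split => /=.
    by apply: leq_trans (size_polyD _ _) _; rewrite geq_max l1 size_polyXn leqnn.
  by rewrite addr0.
by rewrite /= hl; [apply: lowS|]; exact: gP.
Qed.

Lemma sp_oligo n : fin_orbits (gpower sp_gset n).
Proof.
pose D := {ffun 'I_n -> {ffun 'I_n -> F} * {ffun 'I_n -> F}}.
pose dec (c : D) : gpower sp_gset n :=
  fun i => (\sum_j (c i).1 j *: 'X^j, \sum_j (c i).2 j *: 'X^j).
apply: sub_finite_set (finite_image (fun c => gorbit (dec c)) (@finite_finset D setT)).
move=> _ [s _ <-].
pose s' i := if insub i is Some j then s j else 0.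
have [g gP] := move_low n s'.
pose c : D := [ffun i => ([ffun j : 'I_n => (g (s i)).1`_j], [ffun j : 'I_n => (g (s i)).2`_j])].
exists c => //; rewrite -[RHS](gorbit_act s g); congr gorbit; apply/funext => i.
rewrite /dec /= ffunE /=; have := gP i (ltn_ord i); rewrite /s' valK.
case: (g (s i)) => v1 v2 [/= l1 l2].
have E (p : {poly F}) : (size p <= n)%N -> \sum_(j < n) p`_j *: 'X^j = p.
  by move=> pn; rewrite -poly_def; apply/polyP => j; rewrite coef_poly;
    case: ltnP => // nj; rewrite nth_default // (leq_trans pn).
by congr (_, _); rewrite -[RHS]E //; apply: eq_bigr => j _; rewrite ffunE.
Qed.

Definition sp_pair : opair := OPair sp_oligo.
End Space.

Section Shift.
Variable F : finFieldType.
Implicit Types (u v w : spV F) (g h : sp F).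

Definition fixes_ef0 : pred (sp F) :=
  [pred g : sp F | (g (evec F 0) == evec F 0) && (g (fvec F 0) == fvec F 0)].

(* The subgroup G(1) of G, acting below on V(1). *)
Record spG1 := SpG1 { spG1_val : sp F; spG1P : fixes_ef0 spG1_val }.
HB.instance Definition _ := [isSub for spG1_val].
HB.instance Definition _ := [Choice of spG1 by <:].

Lemma fixes_ef0_group : group_closed fixes_ef0.
Proof.
have mul : mulg_closed fixes_ef0.
  move=> g h /andP[/eqP ge /eqP gf] /andP[/eqP he /eqP hf].
  by rewrite inE /= he hf ge gf !eqxx.
have inv : invg_closed fixes_ef0.
  move=> g /andP[/eqP ge /eqP gf]; rewrite inE /= -{1}ge -{1}gf.
  by rewrite !(spinvK g) !eqxx.
split; first by rewrite inE /= !eqxx.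
by move=> g h gP hP; apply: mul => //; exact: inv.
Qed.

HB.instance Definition _ :=
  SubChoice_isSubGroup.Build (sp F) fixes_ef0 spG1 fixes_ef0_group.

Definition in_spV1 v : Prop := exists n (a b : 'I_n -> F),
  v = \sum_(i < n) (a i *: evec F i.+1 + b i *: fvec F i.+1).

Lemma poly_unshift (p : {poly F}) : p = (p`_0)%:P + drop_poly 1 p * 'X.
Proof.
apply/polyP => i; rewrite coefD coefC coefMX coef_drop_poly.
by case: i => [|i]; rewrite ?addr0 // add0r addn1.
Qed.

Lemma in_spV1P v : in_spV1 v <-> v.1`_0 = 0 /\ v.2`_0 = 0.
Proof.
have s1 n (G : 'I_n -> spV F) : (\sum_i G i).1 = \sum_i (G i).1.
  by elim/big_rec2: _ => // i x y _ <-.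
have s2 n (G : 'I_n -> spV F) : (\sum_i G i).2 = \sum_i (G i).2.
  by elim/big_rec2: _ => // i x y _ <-.
split => [[n [a [b ->]]]|[v1 v2]].
  rewrite s1 s2 !coef_sum !big1 // => i _ /=;
  by rewrite coefD !coefZ coef0 coefXn /= !mulr0 addr0.
have [p e1] : exists p, v.1 = p * 'X.
  by exists (drop_poly 1 v.1); rewrite {1}(poly_unshift v.1) v1 add0r.
have [q e2] : exists q, v.2 = q * 'X.
  by exists (drop_poly 1 v.2); rewrite {1}(poly_unshift v.2) v2 add0r.
pose n := maxn (size p) (size q).
exists n, (fun i => p`_i), (fun i => q`_i).
have E (r : {poly F}) : (size r <= n)%N -> r * 'X = \sum_(j < n) r`_j *: 'X^(j.+1).
  move=> rn; have -> : \sum_(j < n) r`_j *: 'X^(j.+1) = (\sum_(j < n) r`_j *: 'X^j) * 'X.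
    by rewrite big_distrl /=; apply: eq_bigr => j _; rewrite exprSr scalerAl.
  congr (_ * _); rewrite -poly_def; apply/polyP => j; rewrite coef_poly.
  by case: ltnP => // nj; rewrite nth_default // (leq_trans rn).
rewrite [v]surjective_pairing [RHS]surjective_pairing s1 s2 e1 e2.
rewrite !E ?leq_maxl ?leq_maxr //; congr (_, _); apply: eq_bigr => i _ /=.
  by rewrite scaler0 addr0.
by rewrite scaler0 add0r.
Qed.

Definition spV1 := {v : spV F | in_spV1 v}.

Lemma spG1_in (g : spG1) v : in_spV1 v -> in_spV1 (val g v).
Proof.
case: g => g /= /andP[/eqP ge /eqP gf] /in_spV1P [v1 v2]; apply/in_spV1P.
split; last by rewrite -spform_e -ge sp_isom spform_e.
by apply: oppr_inj; rewrite -spform_f -gf sp_isom spform_f v1.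
Qed.

Program Definition sp1_gset : gset spG1 := @GSet spG1 spV1
  (fun (x : spG1) (y : spV1) => exist _ (val x (sval y)) (spG1_in x (proj2_sig y))) _ _.
Next Obligation. by move=> [v vP]; apply: eq_exist. Qed.
Next Obligation. by move=> g h [v vP]; apply: eq_exist. Qed.

Definition up v : spV F := (v.1 * 'X, v.2 * 'X).
Definition down v : spV F := (drop_poly 1 v.1, drop_poly 1 v.2).
Definition plane v : spV F := v.1`_0 *: evec F 0 + v.2`_0 *: fvec F 0.

Lemma planeE v : plane v = ((v.1`_0)%:P, (v.2`_0)%:P).
Proof.
rewrite /plane /=; congr (_, _) => /=.
  by rewrite scaler0 addr0 -mul_polyC mulr1.
by rewrite scaler0 add0r -mul_polyC mulr1.
Qed.

Lemma plane_down v : v = plane v + up (down v).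
Proof.
rewrite planeE; case: v => v1 v2; congr (_, _) => /=.
  exact: poly_unshift.
exact: poly_unshift.
Qed.

Lemma down_up v : down (up v) = v.
Proof.
by case: v => v1 v2; congr (_, _) => /=; apply/polyP => i;
  rewrite coef_drop_poly addn1 coefMX.
Qed.

Lemma plane_up v : plane (up v) = 0.
Proof. by rewrite planeE /= !coefMX. Qed.

Lemma down_plane v : down (plane v) = 0.
Proof.
by rewrite planeE; congr (_, _); apply/polyP => i;
  rewrite coef_drop_poly addn1 coefC coef0.
Qed.

Lemma down_linear : linear down.
Proof.
by move=> a [u1 u2] [v1 v2]; congr (_, _) => /=; apply/polyP => i;
  rewrite !(coef_drop_poly, coefD, coefZ).
Qed.

Lemma up_linear : linear up.
Proof.
by move=> a [u1 u2] [v1 v2]; congr (_, _) => /=; rewrite mulrDl scalerAl.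
Qed.

Lemma plane_linear : linear plane.
Proof.
move=> a u v; rewrite !planeE; congr (_, _) => /=;
by rewrite coefD coefZ -mul_polyC polyCD polyCM.
Qed.

HB.instance Definition _ := GRing.isLinear.Build F (spV F) (spV F) _ down down_linear.
HB.instance Definition _ := GRing.isLinear.Build F (spV F) (spV F) _ up up_linear.
HB.instance Definition _ := GRing.isLinear.Build F (spV F) (spV F) _ plane plane_linear.

Lemma plane_plane v : plane (plane v) = plane v.
Proof. by rewrite !planeE /= !coefC. Qed.

Lemma spform_split u v :
  spform u v = spform (plane u) (plane v) + spform (down u) (down v).
Proof.
have [m _ [u1 u2 _ _]] := spform_bound u u 0.
rewrite (@spformE _ m.+1 u) ?leqW // big_ord_recl.
have d (p : {poly F}) : (size p <= m)%N -> (size (drop_poly 1 p) <= m)%N.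
  by move=> pm; rewrite size_drop_poly leq_subLR (leq_trans pm) // leqW.
rewrite (@spformE _ m (down u)) ?d // planeE (@spformE _ 1 (_, _)) ?size_polyC_leq1 //.
rewrite big_ord1 planeE /= !coefC /=; congr (_ + _).
by apply: eq_bigr => i _; rewrite !coef_drop_poly addn1.
Qed.

(* The identity on <e_1, f_1> and g, with indices shifted by one, on V(1). *)
Definition shift_fun g v : spV F := plane v + up (g (down v)).

Lemma plane_shift g v : plane (shift_fun g v) = plane v.
Proof. by rewrite /shift_fun raddfD /= plane_plane plane_up addr0. Qed.

Lemma down_shift g v : down (shift_fun g v) = g (down v).
Proof. by rewrite /shift_fun raddfD /= down_plane down_up add0r. Qed.

Lemma plane_down_inj u v : plane u = plane v -> down u = down v -> u = v.
Proof. by move=> e1 e2; rewrite (plane_down u) (plane_down v) e1 e2. Qed.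

Definition shift_sp g : sp F.
Proof.
exists (shift_fun g) => [a u v||u v].
- apply: plane_down_inj; first by rewrite plane_shift !linearP /= !plane_shift.
  by rewrite down_shift !linearP /= !down_shift sp_linear.
- by exists (shift_fun (spinv g)) => v; apply: plane_down_inj;
    rewrite ?plane_shift ?down_shift ?plane_shift ?down_shift ?spinvK ?spinvVK.
- by rewrite spform_split !plane_shift !down_shift sp_isom -spform_split.
Defined.

Lemma shift_subproof g : fixes_ef0 (shift_sp g).
Proof.
apply/andP; split; apply/eqP; apply: plane_down_inj;
  rewrite ?plane_shift ?down_shift //.
- suff -> : down (evec F 0) = 0 by rewrite sp0.
  by congr (_, _); apply/polyP => i; rewrite coef_drop_poly addn1 ?coefXn !coef0.
- suff -> : down (fvec F 0) = 0 by rewrite sp0.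
  by congr (_, _); apply/polyP => i; rewrite coef_drop_poly addn1 ?coefXn !coef0.
Qed.

Definition shift g : spG1 := SpG1 (shift_subproof g).

Lemma shiftM : {morph shift : g h / (g * h)%g}.
Proof.
move=> g h; apply: val_inj; apply: sp_eq => v /=.
by apply: plane_down_inj; rewrite !(plane_shift, down_shift).
Qed.

Lemma up_in_spV1 v : in_spV1 (up v).
Proof. by apply/in_spV1P; rewrite /= !coefMX. Qed.

Definition shiftV v : spV1 := exist _ (up v) (up_in_spV1 v).

Lemma spV1_down (x : spV1) : x = shiftV (down (sval x)).
Proof.
case: x => v vP; apply: eq_exist => /=; have /in_spV1P[v1 v2] := vP.
by rewrite {1}(plane_down v) planeE v1 v2 polyC0 add0r.
Qed.

Lemma shift_act g v : gact (shift g) (shiftV v : sp1_gset) = shiftV (g v).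
Proof.
apply: eq_exist => /=; apply: plane_down_inj.
  by rewrite plane_shift !plane_up.
by rewrite down_shift !down_up.
Qed.

Lemma shiftV_bij : bijective shiftV.
Proof. by exists (fun x => down (sval x)) => x; rewrite -?spV1_down //= down_up. Qed.

Lemma spG1_plane (h : spG1) v : val h (plane v) = plane v.
Proof. by case: h => h /= /andP[/eqP e /eqP f]; rewrite /plane spD !spZ e f. Qed.

Lemma spG1_plane_up (h : spG1) v : plane (val h (up v)) = 0.
Proof.
have /in_spV1P[e1 e2] := spG1_in h (up_in_spV1 v).
by rewrite planeE e1 e2.
Qed.

Lemma shift_bij : bijective shift.
Proof.
have inj : injective shift.
  move=> g h e; apply: sp_eq => v.
  have : gact (shift g) (shiftV v : sp1_gset) = gact (shift h) (shiftV v : sp1_gset) by rewrite e.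
  by rewrite !shift_act => /(bij_inj shiftV_bij).
have surj (h : spG1) : exists g, shift g = h.
  pose k (x : spG1) v := down (val x (up v)).
  have upk (x : spG1) v : up (k x v) = val x (up v).
    by rewrite [RHS]plane_down spG1_plane_up add0r.
  have kl : linear (k h) by move=> a u v; rewrite /k !linearP sp_linear linearP.
  have kK x y : (x * y = 1)%g -> cancel (k y) (k x).
    move=> xy v; rewrite {1}/k upk.
    have -> : val x (val y (up v)) = val (x * y)%g (up v) by [].
    by rewrite xy down_up.
  have kb : bijective (k h).
    by exists (k h^-1%g); apply: kK; rewrite ?mulVg ?mulgV.
  have ki u v : spform (k h u) (k h v) = spform u v.
    have e x y : spform (down x) (down y) = spform x y - spform (plane x) (plane y).
      by rewrite (spform_split x) addrAC subrr add0r.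
    rewrite /k e !spG1_plane_up sp_isom.
    by rewrite -[in RHS](down_up u) -[in RHS](down_up v) e !plane_up.
  exists (Sp kl kb ki); apply: val_inj; apply: sp_eq => v /=.
  by rewrite /shift_fun /= upk {3}(plane_down v) spD spG1_plane.
by exists (fun x : spG1 => projT1 (cid (surj x))) => x; case: cid => //= y /inj.
Qed.

Lemma shift_fin n : fin_orbits (gpull shiftM (gpower sp1_gset n)).
Proof.
have [m [r rP]] := fin_orbits_reps (@sp_oligo F n).
apply: (@fin_orbits_cover _ (gpull shiftM (gpower sp1_gset n)) m (fun i j => shiftV (r i j))) => s.
have [i [g e]] := rP (fun j => down (sval (s j))); exists i, g.
apply/funext => j /=; rewrite [LHS]spV1_down.
by have := congr1 (fun t => t j) e => /= ->; exact/esym/shift_act.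
Qed.

Definition sp1_pair : opair :=
  OPair (fun n => fin_orbits_gpull (shift_fin n)).

Lemma shift_smooth (A : set (pset sp1_pair)) : finite_set A ->
  exists B : set (pset (sp_pair F)), finite_set B /\ shift @^-1` fixer A = fixer B.
Proof.
move=> fA; exists [set down (sval x) | x in A]; split; first exact: finite_image.
apply/seteqP; split => [g gA _ [x Ax <-]|g gA x Ax].
  apply: (bij_inj shiftV_bij); rewrite -shift_act -spV1_down; exact: gA.
rewrite [x]spV1_down shift_act; congr shiftV.
by apply: (gA (down (sval x))); exists x.
Qed.

Definition shift_hom : pair_hom (sp_pair F) sp1_pair :=
  PairHom shift_smooth shift_fin.

Definition incl (h : spG1) : sp F := val h.

Lemma inclM : {morph incl : g h / (g * h)%g}.
Proof. by []. Qed.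

Lemma incl_smooth (A : set (pset (sp_pair F))) : finite_set A ->
  exists B : set (pset sp1_pair), finite_set B /\ incl @^-1` fixer A = fixer B.
Proof.
move=> fA; exists [set shiftV (down x) | x in A]; split; first exact: finite_image.
apply/seteqP; split => [g gA _ [x Ax <-]|g gA x Ax].
  apply: eq_exist; have := gA x Ax; rewrite /= {1 2}(plane_down x).
  by rewrite /incl spD spG1_plane => /addrI.
have /(_ _)/(congr1 sval) /= := gA (shiftV (down x)).
rewrite /incl => e; rewrite /= {1}(plane_down x) spD spG1_plane e -?plane_down //.
by exists x.
Qed.

Lemma incl_fin n : fin_orbits (gpull inclM (gpower (sp_gset F) n)).
Proof.
pose ext (s : 'I_n -> spV F) : gpower (sp_gset F) (n + 2) := fun i =>
  match fintype.split i with inl j => s j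
  | inr j => if j == ord0 then evec F 0 else fvec F 0 end.
have extl s j : ext s (lshift 2 j) = s j by rewrite /ext (unsplitK (inl j)).
have ext0 s : ext s (rshift n ord0) = evec F 0 by rewrite /ext (unsplitK (inr ord0)).
have ext1 s : ext s (rshift n ord_max) = fvec F 0 by rewrite /ext (unsplitK (inr ord_max)).
apply: sub_finite_set (finite_image
  (fun O => [set s | O (ext s)]) (@sp_oligo F (n + 2))).
move=> _ [s _ <-]; exists (gorbit (ext s)); first by exists (ext s).
apply/seteqP; split => [t /= [g e]|_ [g ->]].
  have ge : fixes_ef0 g.
    apply/andP; split; apply/eqP.
      by rewrite -{1}(ext0 s) -(ext0 t) e.
    by rewrite -{1}(ext1 s) -(ext1 t) e.
  exists (SpG1 ge); apply/funext => j.
  by rewrite -extl e /= extl.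
exists (incl g); apply/funext => i; rewrite /ext /=.
have /andP[/eqP he /eqP hf] := spG1P g.
by case: fintype.split => j //; case: ifP.
Qed.

Definition incl_hom : pair_hom sp1_pair (sp_pair F) :=
  PairHom incl_smooth incl_fin.

(* Restriction from G to G(1), followed by the identification of B(G(1), V(1))
   with B(G, V) given by the isomorphism of pairs ([shift], [shiftV]); see
   [shift_bij], [shiftV_bij] and [shift_act]. *)
Definition delta : {rmorphism burnside (sp_pair F) -> burnside (sp_pair F)} :=
  bpull shift_hom \o bpull incl_hom.

End Shift.

Section Embeddings.
Variables (F : finFieldType) (m n : nat).

(* A symplectic space of dimension 2m, given by coordinates on a symplectic
   basis, plus an n-dimensional space orthogonal to everything. *)
Definition Vmn := ('rV[F]_m * 'rV[F]_m * 'rV[F]_n)%type.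

Definition Vmn_form (u v : Vmn) : F :=
  \sum_(i < m) (u.1.1 0 i * v.1.2 0 i - u.1.2 0 i * v.1.1 0 i).

Definition is_embedding (phi : Vmn -> spV F) :=
  [/\ linear phi, injective phi
    & forall u v, spform (phi u) (phi v) = Vmn_form u v].

Lemma embedding_act (g : sp F) (phi : Vmn -> spV F) : is_embedding phi -> is_embedding (g \o phi).
Proof.
move=> [pl pI pf]; split => [a u v|u v /= e|u v] /=.
- by rewrite pl sp_linear.
- by apply: pI; exact: (bij_inj (sp_bij g)).
- by rewrite sp_isom.
Qed.

Program Definition X_gset : gset (sp F) := @GSet (sp F) {phi | is_embedding phi}
  (fun g phi => exist _ (g \o sval phi) (embedding_act g (proj2_sig phi))) _ _.
Next Obligation. by move=> [phi phiP]; exact: eq_exist. Qed.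
Next Obligation. by move=> g h [phi phiP]; exact: eq_exist. Qed.

Lemma X_smooth : smooth (pset (sp_pair F)) X_gset.
Proof.
move=> phi; exists (range (sval phi)); split.
  exact: finite_image (@finite_finset Vmn setT).
apply/seteqP; split => [g e _ [x _ <-]|g e].
  by rewrite -[in RHS]e.
by case: phi e => phi phiP e; apply: eq_exist; apply/funext => x; apply: e; exists x.
Qed.

Lemma X_fin : fin_orbits X_gset.
Proof.
pose R (s : gpower (sp_gset F) #|{: Vmn}|) (phi : X_gset) :=
  forall k, s k = sval phi (enum_val k).
apply: sub_finite_set (@fin_orbits_rel _ _ _ R (@sp_oligo F _) _ _).
- by move=> _ [phi _ <-]; exists (fun k => sval phi (enum_val k)), phi.
- by move=> g s phi e k; rewrite /= e.
- move=> s [phi p] [psi p'] e e'; apply: eq_exist; apply/funext => x.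
  by have := e (enum_rank x); rewrite e' /= enum_rankK.
Qed.

Definition x_class : burnside (sp_pair F) :=
  gclass (@SGset (sp_pair F) X_gset X_smooth X_fin).

End Embeddings.

(* Main.v *)
(* For a d x d matrix w let Y(w) be the class of the set of d-tuples of vectors
   of V with Gram matrix w.  Splitting V into the plane <e_1, f_1> and V(1) gives
     delta Y(w) = sum_p Y(w - gram p),   p ranging over the d-tuples in the plane.
   With z = x_{0,1} + 1 = Y(0) for d = 1 and x_{1,0} = Y(J) for d = 2, where
   sum_c Y(cJ) = z^2, this yields the two formulas.
   It also makes delta a convolution operator on the functions w |-> Y(w), which a
   discrete Fourier transform diagonalizes: for every matrix e the differences
     [{v | tr(e * gram v) = c}] - [{v | tr(e * gram v) = c + 1}]
   of classes are eigenvectors of delta whose eigenvalue is a power of q, and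
   q^(d^2) Y(w) is a sum of such differences.  By Witt's theorem the linearly
   independent tuples with Gram matrix w form a single orbit, so by induction on d
   the class of every transitive smooth G-set becomes a sum of eigenvectors after
   multiplication by a power of q.  An endomorphism with this property is bijective
   after inverting q. *)

Require Import Defs.
From mathcomp Require Import all_boot all_algebra.
From mathcomp Require Import boolp classical_sets cardinality fsbigop ring.

Set Implicit Arguments.
Unset Strict Implicit.
Unset Printing Implicit Defensive.

Import Defs GRing.Theory.
Local Open Scope classical_set_scope.
Local Open Scope ring_scope.

(** * Additivity of classes over disjoint unions, and counting along additive maps *)

Lemma gclass_disjoint (P : opair) (T : finType) (X : sgset P)
    (Z : T -> sgset P) (f : forall t, Z t -> X) :
  (forall t, injective (f t)) -> (forall t, equivariant (f t)) ->
  (forall t t' z z', f t z = f t' z' -> t = t') ->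
  (forall x, exists t z, x = f t z) ->
  gclass X = \sum_t gclass (Z t).
Proof.
move=> fI fG fD fS.
pose A t := [set [set f t x | x in O] | O in gorbits (Z t)].
have AX t : A t `<=` gorbits X.
  by move=> _ [_ [z _ <-] <-]; exists (f t z) => //; rewrite (gorbit_map z (@fG t)).
(* Writing each class as a sum over all orbits of [X], with zeros, gives every [t] the same index
   set, so the two sums can be exchanged. *)
have AZ t : gclass (Z t) = \sum_(O \in gorbits X) if O \in A t then orbit_class O else 0.
  rewrite -(gclass_map (@fI t) (@fG t)) -[LHS]/(\sum_(O \in A t) _).
  rewrite -(fsbig_mkcondr _ _ (A t)) /=.
  by rewrite setIidr.
rewrite /gclass fsbig_finite; last exact: sg_fin.
under [RHS]eq_bigr => t _ do rewrite -/(gclass (Z t)) AZ (fsbig_finite _ _ (sg_fin X)).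
rewrite exchange_big; apply: eq_big_seq => O /=.
rewrite in_fset_set; last exact: sg_fin.
move=> /set_mem [x _ <-]; have [t [z ->]] := fS x.
rewrite (bigD1 t) //= mem_set; last first.
  by exists (gorbit z); [exists z|rewrite (gorbit_map z (@fG t))].
rewrite big1 ?addr0 // => t' t't; rewrite memNset // => -[_ [z' _ <-] e].
have := gorbit_refl (f t z); rewrite -e => -[y _ /fD e'].
by rewrite e' eqxx in t't.
Qed.

(** The fibres of a surjective additive map are translates of its kernel, so all have the same
    size. *)
Lemma sum_surjective (V M : finZmodType) (phi : V -> M) (B : nmodType) (h : M -> B) :
  {morph phi : x y / x + y} -> (forall c, exists x, phi x = c) ->
  \sum_x h (phi x) = (\sum_c h c) *+ #|[pred x | phi x == 0]|.
Proof.
move=> phiD phiS; rewrite (partition_big phi xpredT) //= -sumrMnl.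
apply: eq_bigr => c _; rewrite (eq_bigr (fun=> h c)) => [|x /eqP ->] //.
rewrite sumr_const; congr (_ *+ _).
have [x0 <-] := phiS c; rewrite -[RHS](card_imset _ (addrI x0)) /=.
apply: eq_card => x; apply/idP/imsetP => [/eqP xc|[y]].
  exists (x - x0); last by rewrite addrC subrK.
  rewrite inE; apply/eqP; apply: (@addrI _ (phi x0)).
  by rewrite -phiD addrC subrK addr0.
by rewrite inE => /eqP y0 ->; apply/eqP; rewrite phiD y0 addr0.
Qed.

Lemma card_surjective (V M : finZmodType) (phi : V -> M) :
  {morph phi : x y / x + y} -> (forall c, exists x, phi x = c) ->
  #|V| = (#|M| * #|[pred x | phi x == 0%R]|)%N.
Proof.
move=> phiD phiS; have := sum_surjective (fun=> 1%N) phiD phiS.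
by rewrite !sum1_card -mulr_natr natn.
Qed.

(** * Endomorphisms diagonalizable with eigenvalues powers of [q] *)

Section EigenSum.
Variables (R : comNzRingType) (f : {rmorphism R -> R}) (q : nat).
Implicit Types (a b : R) (s : seq nat).

Definition eig_prod s a := foldr (fun n x => f x - q%:R ^+ n * x) a s.

(* Stands for "a is a sum of eigenvectors of f over R[1/q]"; annihilation by a
   product of operators f - q^n avoids the denominators of the decomposition. *)
Definition eig_span a := exists l s, q%:R ^+ l * eig_prod s a = 0.

Lemma eig_prodD s a b : eig_prod s (a + b) = eig_prod s a + eig_prod s b.
Proof. by elim: s => //= n s ->; rewrite rmorphD; ring. Qed.

Lemma eig_prodN s a : eig_prod s (- a) = - eig_prod s a.
Proof. by elim: s => //= n s ->; rewrite rmorphN; ring. Qed.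

Lemma eig_prodZ s k a : eig_prod s (q%:R ^+ k * a) = q%:R ^+ k * eig_prod s a.
Proof. by elim: s => //= n s ->; rewrite rmorphM rmorphXn rmorph_nat; ring. Qed.

Lemma eig_prod_cat s t a : eig_prod (s ++ t) a = eig_prod s (eig_prod t a).
Proof. exact: foldr_cat. Qed.

(** A ring morphism fixes the integer [q], so the operators [f - q^n] commute and an innermost
    factor can be moved to the outside. *)
Lemma eig_prod_comm s n a :
  eig_prod s (f a - q%:R ^+ n * a) = eig_prod (n :: s) a.
Proof.
elim: s => //= m s ->; rewrite /= !(rmorphB, rmorphM, rmorphXn, rmorph_nat) /=.
by ring.
Qed.

Lemma eig_prodC s t a : eig_prod (s ++ t) a = eig_prod (t ++ s) a.
Proof.
rewrite !eig_prod_cat; elim: t => //= n t IHt in a *.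
by rewrite eig_prod_comm /= IHt.
Qed.

Lemma eig_prod0 s : eig_prod s 0 = 0.
Proof. by elim: s => //= n s ->; rewrite rmorph0 mulr0 subr0. Qed.

Lemma eig_span0 : eig_span 0.
Proof. by exists 0, [::]; rewrite /= mulr0. Qed.

(** Since the factors commute, the concatenation of the two lists annihilates both summands. *)
Lemma eig_spanD a b : eig_span a -> eig_span b -> eig_span (a + b).
Proof.
have cat0 k l s t x : q%:R ^+ k * eig_prod s x = 0 ->
    q%:R ^+ (k + l) * eig_prod (t ++ s) x = 0.
  move=> e; rewrite addnC exprD -mulrA eig_prod_cat -(eig_prodZ t) e.
  by rewrite eig_prod0 mulr0.
move=> [k [s ea]] [l [t eb]]; exists (k + l)%N, (s ++ t).
by rewrite eig_prodD mulrDr {1}eig_prodC cat0 // addnC cat0 // addr0.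
Qed.

Lemma eig_span_eigen n a : f a = q%:R ^+ n * a -> eig_span a.
Proof. by move=> e; exists 0, [:: n]; rewrite /= e subrr mulr0. Qed.

Lemma eig_spanN a : eig_span a -> eig_span (- a).
Proof. by move=> [k [s ea]]; exists k, s; rewrite eig_prodN mulrN ea oppr0. Qed.

Lemma eig_spanXl k a : eig_span (q%:R ^+ k * a) -> eig_span a.
Proof.
by move=> [l [s ea]]; exists (l + k)%N, s; rewrite exprD -mulrA -eig_prodZ.
Qed.

Lemma eig_span_sum (I : Type) (r : seq I) (Q : pred I) (E : I -> R) :
  (forall i, Q i -> eig_span (E i)) -> eig_span (\sum_(i <- r | Q i) E i).
Proof. by move=> ?; elim/big_ind: _ => //; [exact: eig_span0|exact: eig_spanD]. Qed.

(** Expand the product of the [f - q^n] as a polynomial in [f]: its constant term is a signed power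
    of [q], and the remaining terms are [f r] with [r] a polynomial in [f] applied to [a]. *)
Lemma eig_prod_image s a : exists r,
  eig_prod s a = (-1) ^+ size s * q%:R ^+ sumn s * a + f r /\ (f a = 0 -> f r = 0).
Proof.
elim: s => [|n s [r [IHs r0]]] /=.
  by exists 0; rewrite rmorph0 !mul1r addr0.
exists (eig_prod s a - q%:R ^+ n * r); split; last first.
  by move=> fa; rewrite rmorphB IHs r0 // addr0 !rmorphM fa r0 // !mulr0 subrr.
rewrite rmorphB rmorphM rmorphXn rmorph_nat [in X in _ - X]IHs !exprS exprD; ring.
Qed.

(** Every element is killed by a polynomial in [f] whose constant term is, up to sign, a power of
    [q], hence a unit after inverting [q]; this lets one solve for the element. *)
Lemma eig_span_bijective :
  (forall a, eig_span a) -> bijective (localized_map f q).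
Proof.
move=> all_span.
have inj : injective (localized_map f q).
  apply: raddf_inj => x; have [a [n ->]] := fracP x.
  rewrite [X in X = _]localized_map_frac => /frac_eq [k]; rewrite mulr0 addn0 => e.
  apply/frac_eq.
  have fk : f (q%:R ^+ k * a) = 0 by rewrite rmorphM rmorphXn rmorph_nat.
  (* On an element killed by [f] only the constant term of the annihilating polynomial survives, so
     a power of [q] kills [a]. *)
  have [l [s es]] := all_span (q%:R ^+ k * a).
  have [r [er /(_ fk) r0]] := eig_prod_image s (q%:R ^+ k * a).
  exists (l + sumn s + k)%N; rewrite mulr0 addn0 !exprD.
  move: es; rewrite er r0 addr0 => /(congr1 (fun x => (-1) ^+ size s * x)).
  rewrite mulr0 => <-; rewrite -[LHS](signrMK (size s)); ring.
have surj y : exists x, localized_map f q x = y.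
  have [b [n ->]] := fracP y; have [l [s es]] := all_span b.
  have [r [er _]] := eig_prod_image s b.
  (* The preimage comes from solving [q^l * eig_prod s b = 0] for [b], which puts [q^(l + sumn s)]
     in the denominator. *)
  exists (Defs.frac q (- (-1) ^+ size s * (q%:R ^+ l * r)) (n + l + sumn s)%N).
  rewrite localized_map_frac; apply: frac_eq1.
  rewrite !(rmorphM, rmorphN, rmorphXn, rmorph_nat, rmorph1) !exprD.
  have -> : q%:R ^+ l * f r = - ((-1) ^+ size s * q%:R ^+ (l + sumn s) * b).
    apply/eqP; rewrite -addr_eq0 -[X in _ == X]es er exprD; apply/eqP; ring.
  rewrite -[RHS](signrMK (size s)) exprD; ring.
exists (fun y => projT1 (cid (surj y))) => y; last by case: cid.
by case: cid => x /= xy; apply: inj.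
Qed.
End EigenSum.

(** * Gram matrices and the restriction to G(1) *)

Section Gram.
Variable F : finFieldType.

Definition gram d (v : 'I_d -> spV F) : 'M[F]_d :=
  \matrix_(i, j) spform (v i) (v j).

Lemma vecs_stab d (v : gpower (sp_gset F) d) : stab v = fixer (range v).
Proof.
apply/seteqP; split => [g /= e _ [i _ <-]|g e].
  by rewrite -[in RHS]e.
by apply/funext => i; apply: e; exists i.
Qed.

Lemma vecs_smooth d : smooth (pset (sp_pair F)) (gpower (sp_gset F) d).
Proof.
move=> v; exists (range v); split; last exact: vecs_stab.
exact: finite_image (@finite_finset 'I_d setT).
Qed.

Definition vecs d : sgset (sp_pair F) := SGset (@vecs_smooth d) (@sp_oligo F d).

Lemma gram_invariant d (w : 'M[F]_d) : ginvariant [set v : vecs d | gram v = w].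
Proof.
by move=> g v /= <-; apply/matrixP => i j; rewrite !mxE sp_isom.
Qed.

Definition gram_set d (w : 'M[F]_d) : sgset (sp_pair F) :=
  ssubset (@gram_invariant d w).

Definition GramSet d (w : 'M[F]_d) (v : 'I_d -> spV F) (e : gram v = w) : gram_set w :=
  exist (fun v : vecs d => gram v = w) v e.

Lemma gram_set_inj d (w : 'M[F]_d) (v v' : gram_set w) : sval v =1 sval v' -> v = v'.
Proof. by case: v v' => [v vP] [v' v'P] /= /funext; exact: eq_exist. Qed.

Definition gram_class d (w : 'M[F]_d) := gclass (gram_set w).

Definition pvec (a b : F) : spV F := (a%:P, b%:P).

Lemma plane_pvec a b v : plane (pvec a b + up v) = pvec a b.
Proof. by rewrite linearD /= plane_up addr0 planeE /= !coefC. Qed.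

Lemma down_pvec a b v : down (pvec a b + up v) = v.
Proof.
have -> : pvec a b = plane (pvec a b) by rewrite planeE /= !coefC.
by rewrite linearD /= down_plane down_up add0r.
Qed.

Lemma spform_pvec a b a' b' u v :
  spform (pvec a b + up u) (pvec a' b' + up v) = a * b' - b * a' + spform u v.
Proof.
rewrite spform_split !plane_pvec !down_pvec (@spformE _ 1) ?size_polyC_leq1 //.
by rewrite big_ord1 /= !coefC.
Qed.

(** [p.1] and [p.2] hold the coordinates on e_1 and f_1 of a [d]-tuple in the plane, whose Gram
    matrix this is. *)
Definition plane_gram d (p : 'rV[F]_d * 'rV[F]_d) : 'M[F]_d :=
  p.1^T *m p.2 - p.2^T *m p.1.

Definition add_plane d (p : 'rV[F]_d * 'rV[F]_d) (v : 'I_d -> spV F) i : spV F :=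
  pvec (p.1 0 i) (p.2 0 i) + up (v i).

Lemma gram_add_plane d p (v : 'I_d -> spV F) :
  gram (add_plane p v) = plane_gram p + gram v.
Proof.
by apply/matrixP => i j; rewrite !mxE spform_pvec !big_ord1 !mxE.
Qed.

(** G(1) fixes the plane components of a tuple, so these index disjoint invariant pieces; the sum
    being orthogonal, the components in V(1) have Gram matrix [w - plane_gram p]. *)
Lemma delta_gram d (w : 'M[F]_d) :
  delta F (gram_class w) = \sum_p gram_class (w - plane_gram p).
Proof.
rewrite [LHS]/= /gram_class !bpull_gclass.
have fP p (v : gram_set (w - plane_gram p)) :
    gram (add_plane p (sval v)) = w.
  by case: v => v /= e; rewrite gram_add_plane e addrC subrK.
pose f p (v : gram_set (w - plane_gram p)) :
    spull (shift_hom F) (spull (incl_hom F) (gram_set w)) := GramSet (fP p v).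
apply: (@gclass_disjoint _ _ _ _ f).
- move=> p [v vP] [v' v'P] /= [e]; apply: eq_exist; apply/funext => i.
  by have := congr1 (fun v => down (v i)) e; rewrite !down_pvec.
- move=> p g [v vP]; apply: eq_exist; apply/funext => i.
  apply: plane_down_inj; first by rewrite plane_shift !plane_pvec.
  by rewrite down_shift !down_pvec.
- move=> p p' [v vP] [v' v'P] /= [e].
  have e' i := congr1 (fun v => plane (v i)) e.
  case: p p' e' {vP v'P e} => p1 p2 [p1' p2'] e'.
  by congr (_, _); apply/rowP => i; have := e' i; rewrite !plane_pvec /=;
    [case=> /polyC_inj | case=> _ /polyC_inj].
- move=> [v vP]; pose p := (\row_i (v i).1`_0, \row_i (v i).2`_0).
  have e : v = add_plane p (fun i => down (v i)).
    by apply/funext => i; rewrite {1}(plane_down (v i)) planeE /add_plane !mxE.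
  have zP : gram (fun i => down (v i)) = w - plane_gram p.
    by rewrite -vP [in RHS]e gram_add_plane addrC addKr.
  by exists p, (GramSet zP); apply: eq_exist.
Qed.
End Gram.

Lemma row_functional_surj (F : finFieldType) n (a : 'rV[F]_n) : a != 0 ->
  forall c, exists p : 'rV_n, (a *m p^T) 0 0 = c.
Proof.
case/rV0Pn => i ai c; exists ((c / a 0 i) *: delta_mx 0 i).
rewrite mxE (bigD1 i) //= big1 => [|j ji]; rewrite !mxE !eqxx /=.
  by rewrite mulr1 addr0 mulrC divfK.
by rewrite (negPf ji) !mulr0.
Qed.

Lemma row_functionalD (F : finFieldType) n (a : 'rV[F]_n) :
  {morph (fun p : 'rV_n => (a *m p^T) 0 0) : x y / x + y}.
Proof.
move=> x y; rewrite !mxE -big_split; apply: eq_bigr => i _.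
by rewrite !mxE mulrDr.
Qed.

(** * Action of [delta] on the Gram classes of single vectors and of pairs *)

Section Formulas.
Variable F : finFieldType.
Local Notation q := #|F|.
Local Notation z := (gram_class (0 : 'M[F]_1)).

Lemma q_gt0 : (0 < q)%N.
Proof. by apply/card_gt0P; exists 0. Qed.

Lemma gram1 (v : 'I_1 -> spV F) : gram v = 0.
Proof. by apply/matrixP => i j; rewrite !ord1 !mxE spform_alt. Qed.

Lemma plane_gram1 (p : 'rV[F]_1 * 'rV[F]_1) : plane_gram p = 0.
Proof.
by apply/matrixP => i j; rewrite !ord1 !mxE !big_ord1 !mxE mulrC subrr.
Qed.

Lemma delta_gram1 : delta F z = q%:R ^+ 2 * z.
Proof.
rewrite delta_gram (eq_bigr (fun=> z)) => [|p _]; last by rewrite plane_gram1 subr0.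
by rewrite sumr_const card_prod card_mx mul1n expn1 -[LHS]mulr_natl natrM.
Qed.

(** The Gram matrix of the pair e_1, f_1, with rows (0, 1) and (-1, 0). *)
Definition hyperbolic : 'M[F]_2 := \matrix_(i, j) ((i < j)%N%:R - (j < i)%N%:R).

Lemma ord2P (i : 'I_2) : i = 0 \/ i = 1.
Proof. by case: i => [[|[|//]] i2]; [left|right]; exact: val_inj. Qed.

Lemma sum_ord2 (M : nmodType) (G : 'I_2 -> M) : \sum_i G i = G 0 + G 1.
Proof. by rewrite big_ord_recl big_ord1; congr (_ + G _); exact: val_inj. Qed.

Lemma gram2 (v : 'I_2 -> spV F) : gram v = spform (v 0) (v 1) *: hyperbolic.
Proof.
apply/matrixP => i j; rewrite !mxE.
by have [->|->] := ord2P i; have [->|->] := ord2P j;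
  rewrite ?spform_alt ?[spform (v 1) _]spformC /= ?subrr ?subr0 ?sub0r
    ?mulr0 ?mulr1 ?mulrN1.
Qed.

Lemma plane_gram2 (p : 'rV[F]_2 * 'rV[F]_2) :
  plane_gram p = (p.1 *m hyperbolic *m p.2^T) 0 0 *: hyperbolic.
Proof.
apply/matrixP => i j; rewrite !mxE !big_ord1 !mxE !sum_ord2 !mxE !sum_ord2 !mxE.
by have [->|->] := ord2P i; have [->|->] := ord2P j; rewrite /=; ring.
Qed.

(** Single vectors satisfy no Gram condition, so the square is the class of all pairs of vectors;
    these are sorted by the value of the form. *)
Lemma sum_gram2 : \sum_c gram_class (c *: hyperbolic) = z ^+ 2.
Proof.
rewrite expr2 gclassM; apply/esym.
have fP i (c : F) (v : gram_set (c *: hyperbolic)) : gram (fun _ : 'I_1 => sval v i) = 0.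
  exact: gram1.
pose f (c : F) (v : gram_set (c *: hyperbolic)) :
    sprod (gram_set (0 : 'M[F]_1)) (gram_set (0 : 'M[F]_1)) :=
  (GramSet (fP 0 c v), GramSet (fP 1 c v)).
have f0 c v : sval (f c v).1 0 = sval v 0 by [].
have f1 c v : sval (f c v).2 0 = sval v 1 by [].
have f01 c v : spform (sval (f c v).1 0) (sval (f c v).2 0) = c.
  case: v => v e /=; have := congr1 (fun A : 'M_2 => A 0 1) e.
  by rewrite !mxE /= subr0 mulr1.
apply: (@gclass_disjoint _ _ _ _ f).
- move=> c v v' e; apply: gram_set_inj => i.
  by have [->|->] := ord2P i; rewrite -?f0 -?f1 e.
- by move=> c g v; congr (_, _); apply: eq_exist.
- by move=> c c' v v' e; rewrite -(f01 c v) e f01.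
- move=> [[u uP] [v vP]]; pose w (i : 'I_2) := if i == 0 then u 0 else v 0.
  exists (spform (u 0) (v 0)), (GramSet (gram2 w)).
  by congr (_, _); apply: eq_exist; apply/funext => i; rewrite ord1.
Qed.

(** In the sum over [p], the row [p.1 = 0] gives the first term. For each of the [q^2 - 1] other
    rows the form takes every value on [q] choices of [p.2], which contributes [q * z^2]. *)
Lemma delta_gram2 :
  delta F (gram_class hyperbolic) =
    q%:R ^+ 2 * gram_class hyperbolic + (q%:R ^+ 3 - q%:R) * z ^+ 2.
Proof.
pose h (t : F) := gram_class (hyperbolic - t *: hyperbolic).
have sum_h : \sum_t h t = z ^+ 2.
  (* The substitution [t = 1 - c] turns [hyperbolic - t *: hyperbolic] into [c *: hyperbolic]. *)
  rewrite -sum_gram2 (reindex_inj (inv_inj (subKr 1))); apply: eq_bigr => c _.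
  by rewrite /h -{1}[hyperbolic]scale1r -scalerBl subKr.
rewrite delta_gram (eq_bigr (fun p => h ((p.1 *m hyperbolic *m p.2^T) 0 0))); last first.
  by move=> p _; rewrite plane_gram2.
rewrite -(pair_bigA _ (fun p1 p2 => h ((p1 *m hyperbolic *m p2^T) 0 0))) /=.
rewrite (bigD1 0) //=; congr (_ + _).
  under eq_bigr do rewrite !mul0mx mxE.
  by rewrite sumr_const card_mx mul1n /h scale0r subr0 -[LHS]mulr_natl natrX.
have mul_hyperbolic_neq0 (p : 'rV[F]_2) : p != 0 -> p *m hyperbolic != 0.
  apply: contraNneq => e; apply/eqP/rowP => i; rewrite mxE.
  have := congr1 (fun A : 'rV_2 => A 0 1) e; have := congr1 (fun A : 'rV_2 => A 0 0) e.
  rewrite /= !mxE !sum_ord2 !mxE /= => e0 e1.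
  by have [->|->] := ord2P i; [have := e1|have := e0];
    rewrite /= !(subrr, subr0, sub0r, mulr0, mulr1, mulrN1, add0r, addr0) //;
    move/eqP; rewrite oppr_eq0 => /eqP.
rewrite (eq_bigr (fun=> q%:R * z ^+ 2)) => [|p1 p10].
  rewrite sumr_const -[LHS]mulr_natl mulrA; congr (_ * _).
  rewrite -[#|_|]/#|predC1 (0 : 'rV[F]_2)| cardC1 card_mx mul1n.
  have q20 : (1 <= q ^ 2)%N by rewrite expn_gt0 q_gt0.
  by rewrite -subn1 (natrB _ q20) natrX; ring.
have phiD := row_functionalD (p1 *m hyperbolic).
have phiS := row_functional_surj (mul_hyperbolic_neq0 _ p10).
rewrite (sum_surjective h phiD phiS) sum_h -[LHS]mulr_natl; congr (_%:R * _).
(* The kernel has [q] elements, because [q^2] is [q] times its size. *)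
have := card_surjective phiD phiS; rewrite card_mx mul1n => /eqP.
by rewrite eqn_pmul2l ?q_gt0 // => /eqP.
Qed.
End Formulas.

(** * The classes x_{0,1} and x_{1,0} as Gram classes *)

Section Classes.
Variable F : finFieldType.

Lemma embedding0 m n (phi : Vmn F m n -> spV F) : is_embedding phi -> phi 0 = 0.
Proof.
by case=> phiL _ _; have := phiL (-1) 0 0; rewrite !scaleN1r oppr0 addr0 addNr.
Qed.

(** An embedding of a line with zero form is the choice of a nonzero vector; the extra point
    accounts for the zero vector. *)
Lemma x_class01 : x_class F 0 1 + 1 = gram_class (0 : 'M[F]_1).
Proof.
have -> : 1 = gclass (spoint (sp_pair F)) by [].
rewrite -gclass_sum; apply: gclass_iso.
pose f (s : ssum (SGset (@X_smooth F 0 1) (@X_fin F 0 1)) (spoint (sp_pair F))) :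
    gram_set (0 : 'M[F]_1) :=
  GramSet (gram1 (fun=> if s is inl phi then sval phi (0, 0, 1) else 0)).
have phiE (phi : Vmn F 0 1 -> spV F) u : is_embedding phi ->
    phi u = u.2 0 0 *: phi (0, 0, 1).
  move=> phiP; have [phiL _ _] := phiP.
  have := phiL (u.2 0 0) (0, 0, 1) 0; rewrite embedding0 // !addr0 => <-.
  case: u => [[a b] c]; congr (phi (_, _, _)); try by apply/rowP => -[].
  by apply/rowP => i; rewrite !mxE ord1 mulr1.
have phi1 (phi : Vmn F 0 1 -> spV F) : is_embedding phi -> phi (0, 0, 1) != 0.
  move=> phiP; have [_ phiI _] := phiP; apply/eqP => e.
  have /phiI [] : phi (0, 0, 1) = phi 0 by rewrite embedding0.
  by move=> /matrixP/(_ 0 0)/eqP; rewrite !mxE oner_eq0.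
apply: (@gset_iso_bij _ _ _ f).
- move=> [[phi phiP]|[]] [[psi psiP]|[]] //= [/(congr1 (fun v => v 0))/= e].
  + congr inl; apply: eq_exist; apply/funext => u.
    by rewrite phiE // e -phiE.
  + by have := phi1 _ phiP; rewrite e eqxx.
  + by have := phi1 _ psiP; rewrite -e eqxx.
- move=> [v vP]; have [v0|v0] := eqVneq (v 0) 0.
    by exists (inr tt); apply: eq_exist; apply/funext => i; rewrite ord1.
  have phiP : @is_embedding F 0 1 (fun u => u.2 0 0 *: v 0).
    split => [a x y|x y /eqP|x y].
    + by rewrite !mxE scalerDl scalerA.
    + rewrite -subr_eq0 -scalerBl scaler_eq0 (negPf v0) orbF subr_eq0 => /eqP e.
      case: x y e => [[a b] c] [[a' b'] c'] /= e.
      rewrite (thinmx0 a) (thinmx0 a') (thinmx0 b) (thinmx0 b').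
      by congr (_, _); apply/rowP => i; rewrite ord1.
    + by rewrite spformZl spformZr spform_alt !mulr0 /Vmn_form big_ord0.
  exists (inl (exist _ _ phiP)); apply: eq_exist; apply/funext => i.
  by rewrite ord1 /= !mxE scale1r.
- move=> g [phi|[]]; apply: eq_exist; apply/funext => i //=.
  by rewrite sp0.
Qed.

(** An embedding corresponds to the images of the symplectic basis, which can be any hyperbolic
    pair. *)
Lemma x_class10 : x_class F 1 0 = gram_class (hyperbolic F).
Proof.
apply: gclass_iso.
pose tup (phi : Vmn F 1 0 -> spV F) (i : 'I_2) : spV F :=
  if i == 0 then phi (1, 0, 0) else phi (0, 1, 0).
have tupP (phi : X_gset F 1 0) : gram (tup (sval phi)) = hyperbolic F.
  have [_ _ phiF] := proj2_sig phi; rewrite gram2 /= phiF /Vmn_form big_ord1 !mxE.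
  by rewrite mulr1 mulr0 subr0 scale1r.
pose f (phi : X_gset F 1 0) : gram_set (hyperbolic F) := GramSet (tupP phi).
have phiE (phi : Vmn F 1 0 -> spV F) u : is_embedding phi ->
    phi u = u.1.1 0 0 *: tup phi 0 + u.1.2 0 0 *: tup phi 1.
  move=> phiP; have [phiL _ _] := phiP.
  have := phiL (u.1.2 0 0) (0, 1, 0) 0; rewrite embedding0 // !addr0 => e.
  rewrite /tup /= -e -phiL; case: u {e} => [[a b] c].
  congr (phi (_, _, _)); last by apply/rowP => -[].
    by apply/rowP => i; rewrite !mxE ord1 /= mulr1 mulr0 addr0.
  by apply/rowP => i; rewrite !mxE ord1 /= mulr1 mulr0 add0r.
apply: (@gset_iso_bij _ _ _ f).
- move=> [phi phiP] [psi psiP] /= [e]; apply: eq_exist; apply/funext => u.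
  by rewrite phiE // e -phiE.
- move=> [v vP].
  have v01 : spform (v 0) (v 1) = 1.
    by have := congr1 (fun A : 'M_2 => A 0 1) vP; rewrite !mxE /= subr0.
  pose phi (u : Vmn F 1 0) := u.1.1 0 0 *: v 0 + u.1.2 0 0 *: v 1.
  have phiF u u' : spform (phi u) (phi u') = Vmn_form u u'.
    rewrite /Vmn_form big_ord1 !(spformDl, spformDr, spformZl, spformZr).
    by rewrite !spform_alt (spformC (v 0)) v01; ring.
  have phiP : is_embedding phi.
    split => // [a x y|x y e].
      by rewrite /phi !mxE !scalerDl scalerDr !scalerA addrACA.
    (* Pairing with the two basis vectors recovers the coordinates, so preserving the nondegenerate
       form forces injectivity. *)
    have e0 := phiF x (1, 0, 0); have e1 := phiF x (0, 1, 0).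
    move: e0 e1; rewrite e !phiF /Vmn_form !big_ord1 !mxE /=.
    rewrite !(mulr0, mulr1, subr0, sub0r) => /oppr_inj e2 e1.
    case: x y e e1 e2 => [[a b] c] [[a' b'] c'] /= _ e1 e2.
    by rewrite (thinmx0 c) (thinmx0 c'); congr (_, _, _); apply/rowP => i; rewrite ord1.
  exists (exist _ _ phiP); apply: eq_exist; apply/funext => i.
  have [->|->] := ord2P i; rewrite /tup /phi /= !mxE.
    by rewrite scale1r scale0r addr0.
  by rewrite scale1r scale0r add0r.
- move=> g [phi phiP]; apply: eq_exist; apply/funext => i.
  by have [->|->] := ord2P i.
Qed.
End Classes.

(** * Eigenvectors of [delta] *)

Lemma card_kermx (F : finFieldType) m n (A : 'M[F]_(m, n)) :
  #|[pred p : 'rV_m | p *m A == 0]| = (#|F| ^ \rank (kermx A))%N.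
Proof.
rewrite -[X in (_ ^ X)%N]mul1n -card_mx.
have inj : injective (fun u : 'rV[F]_(\rank (kermx A)) => u *m row_base (kermx A)).
  exact: row_free_inj (row_base_free _).
rewrite -(card_imset _ inj); apply: eq_card => p; rewrite !inE.
apply/eqP/imsetP => [/sub_kermxP|[u _ ->]].
  by rewrite -(eq_row_base (kermx A)) => /submxP [u ->]; exists u.
by apply/sub_kermxP; rewrite -(eq_row_base (kermx A)) submxMl.
Qed.

Lemma mxtraceB (R : pzRingType) n (A B : 'M[R]_n) : \tr (A - B) = \tr A - \tr B.
Proof. exact: raddfB. Qed.

Lemma trace_functionalD (F : finFieldType) d (A : 'M[F]_d) :
  {morph (fun p : 'M_d => \tr (p *m A)) : x y / x + y}.
Proof. by move=> x y; rewrite mulmxDl mxtraceD. Qed.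

Lemma trace_functional_surj (F : finFieldType) d (A : 'M[F]_d) : A != 0 ->
  forall c, exists p : 'M_d, \tr (p *m A) = c.
Proof.
case/matrix0Pn => i [j aij] c; exists ((c / A i j) *: delta_mx j i).
rewrite -scalemxAl mxtraceZ -(mul_delta_mx (0 : 'I_1)) -mulmxA mxtrace_mulC.
by rewrite -rowE -colE trace_mx11 !mxE divfK.
Qed.

Lemma sum_subr (V : finZmodType) (M : nmodType) (h : V -> M) a :
  \sum_c h (a - c) = \sum_c h c.
Proof. by rewrite [RHS](reindex_inj (inv_inj (subKr a))). Qed.

Section GramSpan.
Variables (F : finFieldType) (d : nat).
Local Notation q := #|F|.
Local Notation B := (burnside (sp_pair F)).

(** Plays the part of a nontrivial additive character of [F]: its values sum to zero, yet they are
    integers. *)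
Definition sgn01 (c : F) : B := (c == 0)%:R - (c == 1)%:R.

Lemma sum_sgn01 : \sum_c sgn01 c = 0.
Proof.
have sum_eq a : \sum_(c : F) (c == a)%:R = 1 :> B.
  by rewrite (bigD1 a) //= eqxx big1 ?addr0 // => c /negPf ->.
by rewrite sumrB !sum_eq subrr.
Qed.

(* The class of [tr (e * gram v) = c] minus that of [tr (e * gram v) = c + 1]. *)
Definition gram_eig (e : 'M[F]_d) (c : F) : B :=
  \sum_w sgn01 (\tr (e *m w) - c) * gram_class w.

Lemma sum_gram_eig e : \sum_c gram_eig e c = 0.
Proof.
rewrite exchange_big big1 //= => w _; rewrite -mulr_suml.
by rewrite (sum_subr sgn01) sum_sgn01 mul0r.
Qed.

(** Fourier inversion: for [w'] other than [w] the functional [tr (e * (w' - w))] of [e] is onto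
    [F], so the values of [sgn01] cancel; for [w' = w] each [e] contributes 1. *)
Lemma gram_eig_sum w :
  q%:R ^+ (d * d) * gram_class w = \sum_e gram_eig e (\tr (e *m w)).
Proof.
rewrite exchange_big /= (bigD1 w) //= -mulr_suml.
have -> : \sum_e sgn01 (\tr (e *m w) - \tr (e *m w)) = q%:R ^+ (d * d).
  rewrite (eq_bigr (fun=> 1)) => [|e _]; first by rewrite sumr_const card_mx natrX.
  by rewrite subrr /sgn01 eqxx eq_sym oner_eq0 subr0.
rewrite big1 ?addr0 // => w' w'w.
rewrite -mulr_suml.
under eq_bigr do rewrite -mxtraceB -mulmxBr.
rewrite (sum_surjective sgn01 (trace_functionalD (w' - w))) ?sum_sgn01 ?mul0rn ?mul0r //.
by apply: trace_functional_surj; rewrite subr_eq0.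
Qed.

(** This exhibits the trace as a bilinear form in [p.1] and [p.2], so that for fixed [p.1] it is a
    linear functional of [p.2]. *)
Lemma trace_plane_gram (e : 'M[F]_d) p :
  \tr (e *m plane_gram p) = (p.1 *m (e^T - e) *m p.2^T) 0 0.
Proof.
have tr1 (u v : 'rV_d) : \tr (e *m (u^T *m v)) = (v *m e *m u^T) 0 0.
  by rewrite mulmxA mxtrace_mulC mulmxA trace_mx11.
have trT (u v : 'rV_d) : (u *m e^T *m v^T) 0 0 = (v *m e *m u^T) 0 0.
  by rewrite -{1}(trmxK u) -!trmx_mul mulmxA mxE.
rewrite mulmxBr mxtraceB !tr1 mulmxBr mulmxBl -trT [RHS]mxE.
by congr (_ + _); rewrite [RHS]mxE.
Qed.

(** If [p.1] is outside the kernel of [A], summing over [p.2] runs through all shifts of [c] equally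
    often and gives 0. Each [p.1] in the kernel contributes [q^d] copies, so the eigenvalue is
    [q^(dim ker A + d)]. *)
Lemma delta_gram_eig e c : exists n,
  delta F (gram_eig e c) = q%:R ^+ n * gram_eig e c.
Proof.
pose A := e^T - e.
have -> : delta F (gram_eig e c) = \sum_p gram_eig e (c - \tr (e *m plane_gram p)).
  rewrite rmorph_sum (eq_bigr _ (fun w _ => rmorphM (delta F) _ _)).
  under eq_bigr => w _ do
    rewrite rmorphB !rmorph_nat delta_gram mulr_sumr.
  rewrite exchange_big /=; apply: eq_bigr => p _.
  (* Replacing [w] by [w + plane_gram p] moves the effect of [p] from the Gram class to the shift
     [c]. *)
  rewrite (reindex_inj (addIr (plane_gram p))); apply: eq_bigr => w _ /=.
  by rewrite addrK mulmxDr mxtraceD opprB addrA addrAC.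
under eq_bigr do rewrite trace_plane_gram -/A.
rewrite -(pair_bigA _ (fun p1 p2 => gram_eig e (c - (p1 *m A *m p2^T) 0 0))) /=.
exists (\rank (kermx A) + d)%N.
rewrite (bigID [pred p : 'rV_d | p *m A == 0]) /= [X in _ + X]big1 ?addr0; last first.
  move=> p pA.
  rewrite (sum_surjective (fun t => gram_eig e (c - t)) (row_functionalD (p *m A))).
    by rewrite (sum_subr (gram_eig e)) sum_gram_eig mul0rn.
  exact: row_functional_surj.
rewrite (eq_bigr (fun=> q%:R ^+ d * gram_eig e c)) => [|p /eqP ->].
  by rewrite sumr_const card_kermx -[LHS]mulr_natl natrX mulrA exprD.
under eq_bigr do rewrite mul0mx mxE subr0.
by rewrite sumr_const card_mx mul1n -[LHS]mulr_natl natrX.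
Qed.

Lemma gram_class_span (w : 'M[F]_d) : eig_span (delta F) q (gram_class w).
Proof.
apply: (@eig_spanXl _ _ _ (d * d)); rewrite gram_eig_sum.
apply: eig_span_sum => e _; have [n en] := delta_gram_eig e (\tr (e *m w)).
exact: eig_span_eigen en.
Qed.
End GramSpan.

(** * Witt's theorem and the orbits of tuples *)

Section Witt.
Variable F : finFieldType.
Implicit Types (u v b : spV F) (g : sp F).

(** When [u] and [v] pair nontrivially, a transvection along [v - u], which is orthogonal to [W],
    carries [u] to [v]. Otherwise go through [u + a], with [a] orthogonal to [W] and pairing
    nontrivially with both. *)
Lemma move_perp (W : set (spV F)) u v :
  (forall w, W w -> spform w u = spform w v) ->
  (exists2 b, spform u b != 0 & forall w, W w -> spform w b = 0) ->
  (exists2 b, spform v b != 0 & forall w, W w -> spform w b = 0) ->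
  exists g : sp F, g u = v /\ forall w, W w -> g w = w.
Proof.
have move1 x y : (forall w, W w -> spform w x = spform w y) -> spform x y != 0 ->
    exists g : sp F, g x = y /\ forall w, W w -> g w = w.
  move=> Wxy xy; exists (transvection (y - x) (spform x y)^-1); split => [|w Ww] /=.
    by rewrite /tvfun spformDr spformNr spform_alt subr0 mulVf // scale1r addrC subrK.
  by rewrite /tvfun spformDr spformNr (Wxy w Ww) subrr mulr0 scale0r addr0.
move=> Wuv [b ub Wb] [c vc Wc].
have [uv|] := eqVneq (spform u v) 0; last exact: move1.
(* One of [b], [c] and [b + c] pairs nontrivially with both [u] and [v]. *)
have [a [ua va Wa]] : exists a, [/\ spform u a != 0, spform v a != 0
    & forall w, W w -> spform w a = 0].
  have [vb|vb] := eqVneq (spform v b) 0; last by exists b.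
  have [uc|uc] := eqVneq (spform u c) 0; last by exists c.
  exists (b + c); split => [||w Ww]; rewrite spformDr.
  - by rewrite uc addr0.
  - by rewrite vb add0r.
  - by rewrite Wb // Wc // addr0.
have Wua w : W w -> spform w (u + a) = spform w u.
  by move=> Ww; rewrite spformDr Wa // addr0.
have uua : spform u (u + a) != 0 by rewrite spformDr spform_alt add0r.
have uav : spform (u + a) v != 0 by rewrite spformDl uv add0r spformC oppr_eq0.
have [g [gu gW]] := move1 u (u + a) (fun w Ww => esym (Wua w Ww)) uua.
have [h [ha hW]] := move1 (u + a) v (fun w Ww => etrans (Wua w Ww) (Wuv w Ww)) uav.
by exists (h * g)%g; split => [|w Ww]; rewrite /= ?gu // gW // hW.
Qed.

(* Since the form is nondegenerate, this is linear independence; see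
   [not_sp_free_relation]. *)
Definition sp_free d (v : 'I_d -> spV F) :=
  forall i, exists b, forall j, spform (v j) b = (j == i)%:R.

Lemma sp_free_act d (v : 'I_d -> spV F) g : sp_free v -> sp_free (fun i => g (v i)).
Proof. by move=> fv i; have [b vb] := fv i; exists (g b) => j; rewrite sp_isom. Qed.

(** Match the vectors one at a time by [move_perp], taking for [W] those already matched; the dual
    vectors from [sp_free] supply its nondegeneracy hypotheses. *)
Lemma witt d (v w : 'I_d -> spV F) : sp_free v -> sp_free w -> gram v = gram w ->
  exists g : sp F, forall i, g (v i) = w i.
Proof.
move=> fv fw /matrixP vw.
suff step k : (k <= d)%N -> exists g : sp F, forall i : 'I_d, (i < k)%N -> g (v i) = w i.
  by have [g gP] := step d (leqnn d); exists g => i; exact: gP.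
elim: k => [_|k IHk kd]; first by exists 1%g.
have [g gP] := IHk (ltnW kd); pose i0 := Ordinal kd.
have [|||h [hi0 hW]] := @move_perp [set w i | i in [set i : 'I_d | (i < k)%N]]
    (g (v i0)) (w i0).
- move=> _ [i ik <-]; rewrite -{1}(gP i ik) sp_isom.
  by have := vw i i0; rewrite !mxE.
- have [b vb] := sp_free_act g fv i0; exists b; first by rewrite vb eqxx oner_eq0.
  by move=> _ [i ik <-]; rewrite -(gP i ik) vb -val_eqE /= ltn_eqF.
- have [b vb] := fw i0; exists b; first by rewrite vb eqxx oner_eq0.
  by move=> _ [i ik <-]; rewrite vb -val_eqE /= ltn_eqF.
exists (h * g)%g => i; rewrite ltnS leq_eqVlt => /predU1P [ik|ik] /=.
  by have -> : i = i0 by exact: val_inj.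
by rewrite gP // hW //; exists i.
Qed.

(** Let the rows of [row_mx P Q] be the coordinates of the tuple. A right inverse would yield dual
    vectors, so there is a nonzero row in the left kernel, which is the relation. *)
Lemma not_sp_free_relation d (v : 'I_d -> spV F) : ~ sp_free v ->
  exists (c : 'I_d -> F) i, c i != 0 /\ \sum_j c j *: v j = 0.
Proof.
move=> nfv; pose s i := maxn (size (v i).1) (size (v i).2); pose n := \max_i s i.
have v1 i : (size (v i).1 <= n)%N := leq_trans (leq_maxl _ _) (@leq_bigmax _ s i).
have v2 i : (size (v i).2 <= n)%N := leq_trans (leq_maxr _ _) (@leq_bigmax _ s i).
pose P := \matrix_(i < d, k < n) (v i).1`_k; pose Q := \matrix_(i < d, k < n) (v i).2`_k.
have [/row_freeP [C PQC]|] := boolP (row_free (row_mx P Q)).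
  case: nfv => i.
  (* The form pairs e-coordinates with f-coordinates with opposite signs, hence the swapped blocks
     and the minus sign. *)
  exists (- rVpoly (col i (dsubmx C))^T, rVpoly (col i (usubmx C))^T) => j.
  have := congr1 (fun A : 'M_d => A j i) PQC.
  rewrite -{1}(vsubmxK C) mul_row_col !mxE => <-.
  rewrite (spformE _ (v1 j) (v2 j)) -big_split; apply: eq_bigr => k _ /=.
  by rewrite coefN !coef_rVpoly_ord !mxE mulrN opprK.
rewrite -kermx_eq0 => /rowV0Pn [c /sub_kermxP].
rewrite mul_mx_row -[0]row_mx0 => /eq_row_mx [cP cQ] /rV0Pn [i ci].
exists (c 0), i; split => //.
have coef0 (f : 'I_d -> {poly F}) : (forall j, (size (f j) <= n)%N) ->
    c *m (\matrix_(j < d, k < n) (f j)`_k) = 0 -> \sum_j c 0 j *: f j = 0.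
  move=> fn cf; apply/polyP => k; rewrite coef0 coef_sum.
  have [kn|nk] := ltnP k n; last first.
    by rewrite big1 // => j _; rewrite coefZ nth_default ?mulr0 // (leq_trans _ nk).
  have := congr1 (fun A : 'rV_n => A 0 (Ordinal kn)) cf; rewrite !mxE => e.
  by rewrite -[RHS]e; apply: eq_bigr => j _; rewrite coefZ !mxE.
have sum_pair : \sum_j c 0 j *: v j = (\sum_j c 0 j *: (v j).1, \sum_j c 0 j *: (v j).2).
  elim/big_rec3: _ => // j x1 x2 x3 _ ->.
  by rewrite [c 0 j *: v j]surjective_pairing.
by rewrite sum_pair !coef0.
Qed.

Lemma not_sp_free_fixer d (v : 'I_d -> spV F) : ~ sp_free v ->
  exists d' (v' : 'I_d' -> spV F), (d' < d)%N /\
    fixer (range v : set (sp_gset F)) = fixer (range v' : set (sp_gset F)).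
Proof.
case: d v => [|d] v; first by case=> -[].
move=> /not_sp_free_relation [c [i [ci cv]]].
exists d, (fun j => v (lift i j)); split => //.
have vi : v i = - (c i)^-1 *: \sum_j c (lift i j) *: v (lift i j).
  move: cv; rewrite (bigD1_ord i) //= => /eqP; rewrite addr_eq0 => /eqP civ.
  by rewrite scaleNr -scalerN -civ scalerA mulVf // scale1r.
apply/seteqP; split => g gP _ [j _ <-]; first by apply: gP; exists (lift i j).
have gl k : g (v (lift i k)) = v (lift i k) by apply: gP; exists k.
have [<-|/unlift_some [k -> _]] := eqVneq i j; last exact: gl.
have gsum (r : seq 'I_d) (f : 'I_d -> spV F) :
    g (\sum_(k <- r) f k) = \sum_(k <- r) g (f k).
  by elim/big_rec2: _ => [|k x y _ <-]; rewrite ?sp0 ?spD.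
by rewrite /= vi spZ gsum; congr (_ *: _); apply: eq_bigr => k _; rewrite spZ gl.
Qed.

(** For free [v], the class of its orbit is [gram_class (gram v)] minus the classes of the other
    orbits. By [witt] those consist of dependent tuples, whose stabilizers fix shorter tuples, so
    induction applies. *)
Lemma orbit_span d (v : 'I_d -> spV F) (U : smooth_subgroup (sp_pair F)) :
  ssub U = fixer (range v : set (sp_gset F)) ->
  eig_span (delta F) #|F| (bgen (iclass U)).
Proof.
elim/ltn_ind: d v U => d IHd v U Uv.
have [fv|/not_sp_free_fixer [d' [v' [d'd e]]]] := pselect (sp_free v); last first.
  by apply: (IHd d' d'd v'); rewrite Uv.
have dep_span (w : 'I_d -> spV F) (U' : smooth_subgroup (sp_pair F)) : ~ sp_free w ->
    ssub U' = fixer (range w : set (sp_gset F)) ->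
    eig_span (delta F) #|F| (bgen (iclass U')).
  move=> /not_sp_free_fixer [d' [w' [d'd e]]] U'w.
  by apply: (IHd d' d'd w'); rewrite U'w.
have stabE (w : gram_set (gram v)) : stab w = fixer (range (sval w) : set (sp_gset F)).
  rewrite -vecs_stab; case: w => w wP.
  by apply/seteqP; split => [g /(congr1 sval) //|g e]; exact: eq_exist.
pose v0 : gram_set (gram v) := GramSet (erefl (gram v)).
have -> : iclass U = iclass (sstab v0).
  by congr iclass; apply: smooth_subgroup_eq; rewrite Uv /= stabE.
rewrite -orbit_class_gorbit.
have finO : finite_set (gorbits (gram_set (gram v)) `\ gorbit v0).
  exact/finite_setD/sg_fin.
pose rest := \sum_(O \in gorbits (gram_set (gram v)) `\ gorbit v0) orbit_class O.
have vE : gram_class (gram v) = orbit_class (gorbit v0) + rest.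
  by apply: (fsbigD1 (gorbit v0)); [exact: sg_fin|exists v0].
suff span_rest : eig_span (delta F) #|F| rest.
  rewrite -[orbit_class _](addrK rest) -vE.
  by apply: eig_spanD; [exact: gram_class_span|exact: eig_spanN].
rewrite /rest fsbig_finite // big_seq; apply: eig_span_sum => O.
rewrite in_fset_set // => /set_mem [[w _ <-] nvw]; rewrite orbit_class_gorbit.
apply: (dep_span (sval w)) => [fw|]; last exact: stabE.
case: nvw; case: w fw => w wP fw.
have [g gP] := witt fv fw (esym wP).
by apply: gorbit_eq; exists g; apply: eq_exist; apply/funext => i /=; rewrite gP.
Qed.

Lemma delta_span a : eig_span (delta F) #|F| a.
Proof.
apply: burnside_ind a => [U|a b sa sb|]; last exact: eig_span0.
  have [A [/finite_set_tuple [n [v ->]] UA]] := ssubP U.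
  by rewrite gclass_coset; exact: orbit_span UA.
by apply: eig_spanD => //; exact: eig_spanN.
Qed.
End Witt.

Theorem proposition8p5 (F : finFieldType) (q : nat) (Fq : #|F| = q) :
  [/\ delta F (x_class F 1 0) =
        q%:R ^+ 2 * x_class F 1 0
        + (q%:R ^+ 3 - q%:R) * (x_class F 0 1 + 1) ^+ 2,
      delta F (x_class F 0 1) =
        q%:R ^+ 2 * x_class F 0 1 + q%:R ^+ 2 - 1
    & bijective (localized_map (delta F) q)].
Proof.
subst q; split.
- by rewrite x_class01 x_class10 delta_gram2.
(* Here x_{0,1} is [z - 1], where [delta] multiplies [z] by [q^2] and fixes 1. *)
- rewrite -[x_class F 0 1](addrK 1) x_class01 rmorphB rmorph1 delta_gram1; ring.
- exact: eig_span_bijective (@delta_span F).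
Qed.
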